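(* Let $\sigma,b:[0,+\infty)\to\mathbb{R}$ satisfy conditions (i)--(iv) listed in the context. Let $\{X_{s,t}\}_{s\le t}$ be the $(\sigma,b,w)$-stochastic flow with the absorbing barrier at $0$, let $T>0$, $n\in\mathbb{N}$, and let $\{X^{n}_{k,l}\}_{k\le l}$ be its Euler--Maruyama approximation with step $h=T/n$. Let $\{X^{*}_{s,t}\}_{s\le t}$ and $\{X^{n*}_{k,l}\}_{k\le l}$ be the corresponding dual flows. Let $f:[0,+\infty)\to\mathbb{R}$ be a differentiable function with $f(0)=0$ and with compact support. Then for $x>0$, $$\mathbf{E}[f(X^{*}_{0,T}(x))]-\mathbf{E}[f(X^{n*}_{0,n}(x))]=\int_{0}^{+\infty}f'(y)\left(\mathbf{P}(X^{n}_{0,n}(y)>x)-\mathbf{P}(X_{0,T}(y)>x)\right)\mathrm{d}y .$$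
   Context: Let $w=(w(t))_{t\in\mathbb{R}}$ be a one-dimensional Wiener process indexed by $\mathbb{R}$, and for $s\in\mathbb{R}$ put $w^{(s)}(t)=w(t)-w(s)$, $t\ge s$. Let $\sigma,b$ be Borel-measurable functions on $[0,+\infty)$. Conditions: (i) $\sigma(x)>0$ for $x\in(0,+\infty)$. (ii) $\sigma|_{(0,+\infty)}$ and $b|_{(0,+\infty)}$ belong to $C^2(0,+\infty)$ and their first derivatives are bounded on $[1,+\infty)$. (iii) $\displaystyle\int_{0+}^{1}\Big(\frac{1}{\sigma(x)^2}\exp\Big(-\int_x^1\frac{2b(y)}{\sigma(y)^2}\mathrm{d}y\Big)+\exp\Big(\int_x^1\frac{2b(y)}{\sigma(y)^2}\mathrm{d}y\Big)\Big)\mathrm{d}x<+\infty$. (iv) Condition (iii) still holds if $b$ is replaced by $\widehat b(x):=\sigma(x)\sigma'(x)-b(x)$. Absorbing flow: for $s\in\mathbb{R}$ and $x>0$, let $(X_t)_{t\ge s}$ be the unique strong solution, as long as it moves in $(0,+\infty)$, of $\mathrm{d}X_t=\sigma(X_t)\mathrm{d}w^{(s)}(t)+b(X_t)\mathrm{d}t$, $X_s=x$. In this setting there is a finite random time $\tau^{s,x}>s$ such that $\lim_{t\to\tau^{s,x}}X_t=0$ almost surely. Put $X_{s,t}(x):=X_t$ for $t\in[s,\tau^{s,x})$, $X_{s,t}(x):=0$ for $t\ge\tau^{s,x}$, and $X_{s,t}(0):=X_{s,t}(0+)$. Each $X_{s,t}$ is a random non-decreasing right-continuous map $[0,+\infty)\to[0,+\infty)$.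 The family $\{X_{s,t}\}_{s\le t}$ is the $(\sigma,b,w)$-stochastic flow with the absorbing barrier at $0$. Euler--Maruyama approximation: with $h=T/n$, $t_k=kh$ ($k\in\mathbb{Z}$), $\Delta w_k=w(t_k)-w(t_{k-1})$, $\Delta t_k=h$, put for integers $k\le l$ and $x>0$: $X^n_{k,k}(x)=x$ and, for $k<l$, $$X^n_{k,l}(x)=1_{(0,+\infty)}(X^n_{k,l-1}(x))\,\max\{0,\;X^n_{k,l-1}(x)+\sigma(X^n_{k,l-1}(x))\Delta w_l+b(X^n_{k,l-1}(x))\Delta t_l\},$$ and $X^n_{k,l}(0):=X^n_{k,l}(0+)$. This family is called the Euler--Maruyama approximation of the flow if (as part of the definition) $X^n_{k,l}:[0,+\infty)\to[0,+\infty)$ is non-decreasing almost surely for each $k\le l$. Dual flows (right-continuous inverses, maps $[0,+\infty)\to[0,+\infty)$): $X^{*}_{s,t}(x):=\inf\{y\ge0:X_{-t,-s}(y)>x\}$ for real $s\le t$, and $X^{n*}_{k,l}(x):=\inf\{y\ge0:X^n_{-l,-k}(y)>x\}$ for integers $k\le l$.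
   Formalization: The formal theorem additionally assumes that the integrand f'(y)(P(X^n_{0,n}(y)>x) − P(X_{0,T}(y)>x)) is Lebesgue integrable on (0,+∞); for a merely differentiable f the integral on the right may otherwise be undefined. *)

(* Defs.v *)
(* Functions on [0, +oo) are total functions R -> R of which
   only the values on [0, +oo) are used. *)
From HB Require Import structures.
From mathcomp Require Import all_boot all_order all_algebra.
From mathcomp Require Import all_classical all_reals all_analysis.
Set Implicit Arguments.
Unset Strict Implicit.
Unset Printing Implicit Defensive.
Import Order.TTheory GRing.Theory Num.Theory numFieldNormedType.Exports.
Local Open Scope ring_scope.
Local Open Scope classical_set_scope.

Section coefficients.
Context {R : realType}.
Local Notation mu := (@lebesgue_measure R).
Implicit Types sigma b f : R -> R.

Definition C2_pos f := forall x : R, 0 < x ->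
  [/\ derivable f x 1, derivable f^`() x 1 & {for x, continuous f^`()^`()}].

Definition bounded_derivative_from1 f :=
  exists M : R, forall x : R, 1 <= x -> `|f^`() x| <= M.

Definition boundary_integral_finite sigma b :=
  let S (x : R) : R := \int[mu]_(y in `[x, 1]) (2 * b y / sigma y ^+ 2) in
  (\int[mu]_(x in `]0%R, 1%R])
     ((sigma x ^+ 2)^-1 * expR (- S x) + expR (S x))%R%:E < +oo)%E.

Definition dual_drift sigma b : R -> R := fun x => sigma x * derive1 sigma x - b x.

Definition standing_conditions sigma b :=
  [/\ forall x : R, 0 < x -> 0 < sigma x,
      [/\ C2_pos sigma, C2_pos b,
          bounded_derivative_from1 sigma & bounded_derivative_from1 b],
      boundary_integral_finite sigma b
    & boundary_integral_finite sigma (dual_drift sigma b)].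

End coefficients.

Section wiener.
Context {d : measure_display} {Omega : measurableType d} {R : realType}.
Variable P : probability Omega R.
Implicit Type w : R -> Omega -> R.

(* The second parameter of normal_prob is the standard deviation. *)
Definition is_wiener w :=
  [/\ forall t, measurable_fun setT (w t),
      {ae P, forall omega, w 0 omega = 0 /\ continuous (w ^~ omega)},
      forall s t, s < t -> forall B : set R, measurable B ->
        P [set omega | B (w t omega - w s omega)]
          = normal_prob 0 (Num.sqrt (t - s)) B
    & forall (N : nat) (u : nat -> R) (B : nat -> set R),
        (forall i, u i <= u i.+1) -> (forall i, measurable (B i)) ->
        let E i := [set omega | B i (w (u i.+1) omega - w (u i) omega)] in
        P [set omega | forall i, (i < N)%N -> E i omega]
          = (\prod_(i < N) P (E i))%E].

Definition wiener_from w (s : R) : R -> Omega -> R :=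
  fun t omega => w t omega - w s omega.

(* P-completed filtration generated by the driver w^(s) on [s, t]. *)
Definition filtration_from w (s t : R) : set (set Omega) :=
  [set A | measurable A /\ exists2 A',
    <<s [set C | exists r (B : set R), [/\ s <= r <= t, measurable B
                                         & C = wiener_from w s r @^-1` B]] >> A'
    & P.-negligible (A `+` A')].

End wiener.

Section ito_integral.
Context {d : measure_display} {Omega : measurableType d} {R : realType}.
Variable P : probability Omega R.
Local Notation mu := (@lebesgue_measure R).
Implicit Types (F : R -> set (set Omega)) (w : R -> Omega -> R) (A : set Omega).

Record simple_process := SimpleProcess {
  sp_size : nat;
  sp_knot : nat -> R;
  sp_coef : nat -> Omega -> R }.

Definition is_simple F (s t : R) (H : simple_process) :=
  [/\ sp_knot H 0 = s, sp_knot H (sp_size H) = t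
    & forall i, (i < sp_size H)%N ->
      [/\ sp_knot H i <= sp_knot H i.+1,
          exists c : R, forall omega, `|sp_coef H i omega| <= c
        & forall B : set R, measurable B ->
            F (sp_knot H i) (sp_coef H i @^-1` B)]].

Definition simple_val (H : simple_process) (u : R) (omega : Omega) : R :=
  \sum_(i < sp_size H)
     sp_coef H i omega * \1_(`]sp_knot H i, sp_knot H i.+1]) u.

Definition simple_integral w (H : simple_process) (omega : Omega) : R :=
  \sum_(i < sp_size H)
     sp_coef H i omega * (w (sp_knot H i.+1) omega - w (sp_knot H i) omega).

Definition vanishes_in_probability_on A (Y : nat -> Omega -> \bar R) :=
  forall e : R, 0 < e ->
    P (A `&` [set omega | (e%:E < Y k omega)%E]) @[k --> \oo] --> 0%E.

(* I is the Ito integral of H against w over [s, t], on the event A: the limit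
   in probability of the elementary integrals of simple processes whose squared
   L^2([s, t]) distance to H tends to 0 in probability.  The event A is needed
   because the integrand below exists only up to the lifetime of the solution;
   by localisation the value of I on A does not depend on the approximation. *)
Definition is_ito_integral_on F w (s t : R) A (H : R -> Omega -> R)
    (I : Omega -> R) :=
  exists Hn : nat -> simple_process,
    [/\ forall k, is_simple F s t (Hn k),
        vanishes_in_probability_on A (fun k omega =>
          \int[mu]_(u in `[s, t])
             ((simple_val (Hn k) u omega - H u omega) ^+ 2)%R%:E)%E
      & vanishes_in_probability_on A (fun k omega =>
          `|simple_integral w (Hn k) omega - I omega|%:E)].

End ito_integral.

Section flows.
Context {d : measure_display} {Omega : measurableType d} {R : realType}.
Variable P : probability Omega R.
Variables sigma b : R -> R.
Variable w : R -> Omega -> R.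
Local Notation mu := (@lebesgue_measure R).

(* dX = sigma(X) dw^(s) + b(X) dt, X_s = x, in (0, +oo) up to the lifetime tau.
   The drift need not make 0 accessible with probability one, so tau may take
   the value +oo; when it is finite, X tends to 0 there.  The values of X at and
   after tau are irrelevant. *)
Definition is_strong_solution (s x : R) (tau : Omega -> \bar R)
    (X : R -> Omega -> R) :=
  let F := filtration_from P w s in
  [/\ forall t (B : set R), s <= t -> measurable B ->
        F t [set omega | (t%:E < tau omega)%E /\ B (X t omega)],
      forall omega,
        [/\ (s%:E < tau omega)%E,
            X s omega = x,
            forall t, s <= t -> (t%:E < tau omega)%E -> 0 < X t omega,
            {within [set t | s <= t /\ (t%:E < tau omega)%E],
               continuous (X ^~ omega)}
          & forall r, tau omega = r%:E -> X t omega @[t --> r^'-] --> 0]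
    & forall t, s <= t ->
        is_ito_integral_on P F (wiener_from w s) s t
          [set omega | (t%:E < tau omega)%E]
          (fun u omega => sigma (X u omega))
          (fun omega => X t omega - x - \int[mu]_(u in `[s, t]) b (X u omega))].

Definition is_unique_strong_solution (s x : R) (tau : Omega -> \bar R)
    (X : R -> Omega -> R) :=
  is_strong_solution s x tau X /\
  forall tau' X', is_strong_solution s x tau' X' ->
    {ae P, forall omega, tau' omega = tau omega /\
       forall t, s <= t -> (t%:E < tau omega)%E -> X' t omega = X t omega}.

Definition absorbed (tau : Omega -> \bar R) (X : R -> Omega -> R) (t : R)
    (omega : Omega) : R :=
  if (t%:E < tau omega)%E then X t omega else 0.

(* X s t x omega is X_{s,t}(x)(omega).  For a fixed starting point the solution
   is determined up to a null set only; the second clause selects the version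
   that is monotone and right-continuous in x, and at x = 0 it reads
   X_{s,t}(0) = X_{s,t}(0+). *)
Definition is_absorbing_flow (X : R -> R -> R -> Omega -> R) :=
  [/\ forall s t x : R, s <= t -> 0 <= x -> measurable_fun setT (X s t x),
      forall s t, s <= t -> {ae P, forall omega,
        [/\ forall x : R, 0 <= x -> 0 <= X s t x omega,
            forall x y : R, 0 <= x -> x <= y -> X s t x omega <= X s t y omega
          & forall x : R, 0 <= x ->
              X s t y omega @[y --> x^'+] --> X s t x omega]}
    & forall s x : R, 0 < x -> exists tau Y,
        is_unique_strong_solution s x tau Y /\
        {ae P, forall omega, forall t, s <= t ->
           X s t x omega = absorbed tau Y t omega}].

Definition grid (h : R) (k : int) : R := k%:~R * h.

(* Xn k l x omega is X^n_{k,l}(x)(omega), with time step h. *)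
Definition is_euler_maruyama (h : R) (Xn : int -> int -> R -> Omega -> R) :=
  [/\ forall (k : int) (x : R) omega, 0 < x -> Xn k k x omega = x,
      forall (k l : int) (x : R) omega, k < l -> 0 < x ->
        let y := Xn k (l - 1) x omega in
        Xn k l x omega =
          \1_(`]0, +oo[) y *
          Num.max 0 (y + sigma y * (w (grid h l) omega - w (grid h (l - 1)) omega)
                       + b y * h),
      forall k l : int, k <= l -> {ae P, forall omega,
        Xn k l y omega @[y --> 0^'+] --> Xn k l 0 omega}
    & forall k l : int, k <= l -> {ae P, forall omega, forall x y : R,
        0 <= x -> x <= y -> Xn k l x omega <= Xn k l y omega}].

(* inf set0 = 0 in the library, so the right-continuous inverse takes the value
   0 instead of +oo at a point that g does not exceed.  The two conventions agree
   for test functions that vanish at 0 and outside a bounded set. *)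
Definition rc_inverse (g : R -> R) (x : R) : R := inf [set y | 0 <= y /\ x < g y].

Definition dual_flow (X : R -> R -> R -> Omega -> R) (s t x : R)
    (omega : Omega) : R :=
  rc_inverse (fun y => X (- t) (- s) y omega) x.

Definition dual_euler_maruyama (Xn : int -> int -> R -> Omega -> R)
    (k l : int) (x : R) (omega : Omega) : R :=
  rc_inverse (fun y => Xn (- l) (- k) y omega) x.

End flows.

(* At 0 the derivative is one-sided. *)
Definition differentiable_from0 {R : realType} (f : R -> R) :=
  (exists l : R, (f u - f 0) / u @[u --> 0^'+] --> l) /\
  forall y : R, 0 < y -> derivable f y 1.

Definition compact_support_from0 {R : realType} (f : R -> R) :=
  compact (closure [set y | 0 <= y /\ f y != 0]).

(* Main.v *)
(** Let Y be the dual flow at [x].  Monotonicity in the starting point turns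
    [{X_{-T,0}(y) > x}] into [{Y <= y}] up to the event [{Y = y}], which is null
    for almost every [y].  The function [y |-> E f(min(Y, y))] is continuous, has the
    right derivative [f'(y) P(Y > y)] everywhere, vanishes at [0] and equals
    [E f(Y)] beyond the support of [f].  The same holds for the approximation, and a
    continuous function with an everywhere finite, integrable right derivative is
    the integral of that derivative.  The derivative [f'] alone need not be
    integrable, so the two expectations cannot be treated separately in this last
    step.

    It remains to replace the starting time [-T] by [0].  For the Euler-Maruyama
    scheme this holds because the scheme is an explicit functional of the driving
    path, and paths of [w] from different starting times have the same law.  The
    strong solution is likewise a functional of the path, but only almost surely:
    evaluating this functional on the path from the other starting time gives a
    strong solution there, which is the given one by uniqueness. *)
Require Import Defs.
From HB Require Import structures.
From mathcomp Require Import all_boot all_order all_algebra.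
From mathcomp Require Import all_classical all_reals all_analysis.
From mathcomp Require Import measurable_realfun ring lra.
Set Implicit Arguments.
Unset Strict Implicit.
Unset Printing Implicit Defensive.
Import Order.TTheory GRing.Theory Num.Theory numFieldNormedType.Exports.
Local Open Scope ring_scope.
Local Open Scope classical_set_scope.

(** * The law of the driving path *)

(** A derivative from the right is used because the dual variable [Y] may have atoms: at an atom
    [y > 0] the left slope of [E f(min(Y, y))] is [f'(y) P(Y >= y)], which in general differs from
    the right slope. The Ito integral is characterised only through approximating simple processes.
    A solution is therefore moved to another starting time together with its approximating sequence:
    each coefficient is a functional of the path up to its knot, and both convergence conditions
    become statements about the law of the path. Continuity is not an event of the product
    sigma-algebra on path space, so the functional that yields the solution is rebuilt from its
    values at rational times. *)

Section eq_law.
Context {d : measure_display} {Omega : measurableType d} {R : realType}.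
Variable P : probability Omega R.

Lemma eq_law_generated (T : pointedType) (G : set (set T))
    (f g : Omega -> g_sigma_algebraType G) :
  setI_closed G -> measurable_fun setT f -> measurable_fun setT g ->
  (forall A, G A -> P (f @^-1` A) = P (g @^-1` A)) ->
  forall A, <<s G >> A -> P (f @^-1` A) = P (g @^-1` A).
Proof.
move=> GI mf mg Gfg.
have mfp A : <<s G >> A -> measurable (f @^-1` A).
  by move=> mA; rewrite -[X in measurable X]setTI; exact: mf.
have mgp A : <<s G >> A -> measurable (g @^-1` A).
  by move=> mA; rewrite -[X in measurable X]setTI; exact: mg.
have trivIset_preimage (h : Omega -> T) F : trivIset [set: nat] F ->
    trivIset [set: nat] (fun n => h @^-1` F n).
  by move=> tF i j _ _ [x [xi xj]]; apply: tF => //; exists (h x).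
apply: (@dynkin_induction _ (g_sigma_algebraType G) G) => //.
- move=> S mS fgS; have -> : f @^-1` (~` S) = ~` (f @^-1` S) by [].
  have -> : g @^-1` (~` S) = ~` (g @^-1` S) by [].
  by rewrite (probability_setC _ (mfp _ mS)) (probability_setC _ (mgp _ mS)) fgS.
- move=> F mF tF fgF; rewrite (preimage_bigcup setT f F).
  rewrite (preimage_bigcup setT g F) measure_bigcup//; last 2 first.
  + by move=> i _; apply: mfp; exact: mF.
  + exact: trivIset_preimage.
  rewrite measure_bigcup//; last 2 first.
  + by move=> i _; apply: mgp; exact: mF.
  + exact: trivIset_preimage.
  by apply: eq_eseriesr => i _; exact: fgF.
Qed.

End eq_law.

(* Recentring at [p 0] makes the sigma-algebra insensitive to the value of the path
   at its starting time. *)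
Definition coord_sets {R : realType} (D : set R) : set (set (R -> R)) :=
  [set C | exists r (B : set R),
    [/\ D r, measurable B & C = [set p | B (p r - p 0)]]].

Definition path_space {R : realType} (D : set R) :=
  g_sigma_algebraType (coord_sets D).

Definition path_from {R : realType} {Omega : Type} (w : R -> Omega -> R)
  (s : R) (omega : Omega) : R -> R := fun r => w (s + r) omega.

Lemma measurable_coord {R : realType} (D : set R) (r : R) : D r ->
  measurable_fun setT (fun p : path_space D => p r - p 0).
Proof.
move=> Dr _ B mB; rewrite setTI; apply: sub_sigma_algebra.
by exists r, B.
Qed.

Section path_law.
Context {d : measure_display} {Omega : measurableType d} {R : realType}.
Variable P : probability Omega R.
Variable w : R -> Omega -> R.
Hypothesis w_wiener : is_wiener P w.

Lemma measurable_path_from (D : set R) (s : R) :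
  measurable_fun setT (path_from w s : Omega -> path_space D).
Proof.
case: w_wiener => mw _ _ _.
apply: (@measurability _ _ _ (path_space D) _ _ (coord_sets D)) => //.
move=> _ [_ [r [B [Dr mB ->]]] <-]; rewrite setTI.
rewrite -[X in measurable X]setTI.
by apply: (measurable_funB (mw (s + r)) (mw (s + 0))).
Qed.

Let increment_sets (u : nat -> R) (N : nat) : set (set (R -> R)) :=
  [set C | exists2 B : nat -> set R, (forall i, measurable (B i)) &
     C = [set p | forall i, (i < N)%N -> B i (p (u i.+1) - p (u i))]].

Let increment_setsI u N : setI_closed (increment_sets u N).
Proof.
move=> _ _ [B mB ->] [B' mB' ->]; exists (fun i => B i `&` B' i).
  by move=> i; exact: measurableI.
apply/seteqP; split => [p [BB BB'] i iN|p BB] /=; first by split; auto.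
by split => i iN; case: (BB i iN).
Qed.

(** Independence splits the rectangle into single increments, and the Gaussian law of an increment
    depends on the elapsed time only. *)
Let increment_law u N (s s' : R) : (forall i, u i <= u i.+1) ->
  forall C, increment_sets u N C ->
  P (path_from w s @^-1` C) = P (path_from w s' @^-1` C).
Proof.
case: w_wiener => mw _ gauss indep uS _ [B mB ->].
have us t i : t + u i <= t + u i.+1 by rewrite lerD2l.
have := indep N (fun i => s + u i) B (us s) mB.
have := indep N (fun i => s' + u i) B (us s') mB.
rewrite /preimage /path_from /= => -> ->; apply: eq_bigr => i _.
(* [is_wiener] prescribes the law over intervals of positive length; a repeated grid time gives the
   increment 0 on both sides. *)
have [uu|uu] := eqVneq (u i) (u i.+1).
  by rewrite uu; congr (P _); apply/seteqP; split => om /=; rewrite !subrr.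
have uu' : u i < u i.+1 by rewrite lt_neqAle uu uS.
have lt_s t : t + u i < t + u i.+1 by rewrite ltrD2l.
have gs := gauss _ _ (lt_s s) _ (mB i).
have gs' := gauss _ _ (lt_s s') _ (mB i).
have E : s' + u i.+1 - (s' + u i) = s + u i.+1 - (s + u i) by ring.
rewrite E -gs in gs'.
exact: esym.
Qed.

Let measurable_increment u N i : (i < N)%N ->
  measurable_fun setT
    (fun p : g_sigma_algebraType (increment_sets u N) => p (u i.+1) - p (u i)).
Proof.
move=> iN _ B mB; rewrite setTI; apply: sub_sigma_algebra.
exists (fun j => if j == i then B else setT); first by move=> j; case: ifP.
apply/seteqP; split => [p Bp j jN|p Bp] /=; first by case: eqP => // ->.
by have := Bp i iN; rewrite eqxx.
Qed.

Let measurable_path_increment u N s :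
  measurable_fun setT
    (path_from w s : Omega -> g_sigma_algebraType (increment_sets u N)).
Proof.
case: w_wiener => mw _ _ _.
apply: (@measurability _ _ _
  (g_sigma_algebraType (increment_sets u N)) _ _ (increment_sets u N)) => //.
move=> _ [_ [B mB ->] <-]; rewrite setTI.
rewrite (_ : _ @^-1` _ = \bigcap_(i in [set i | (i < N)%N])
   ((fun om => w (s + u i.+1) om - w (s + u i) om) @^-1` B i)).
  apply: bigcap_measurableType => // i _; rewrite -[X in measurable X]setTI.
  exact: (measurable_funB (mw (s + u i.+1)) (mw (s + u i))).
by apply/seteqP; split.
Qed.

Let cylinders (D : set R) : set (set (R -> R)) :=
  [set C | exists N (r : nat -> R) (B : nat -> set R),
    [/\ forall i, D (r i), forall i, measurable (B i)
      & C = [set p | forall i, (i < N)%N -> B i (p (r i) - p 0)]]].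

Let cylindersI D : setI_closed (cylinders D).
Proof.
move=> _ _ [N [r [B [Dr mB ->]]]] [N' [r' [B' [Dr' mB' ->]]]].
exists (N + N')%N, (fun i => if (i < N)%N then r i else r' (i - N)%N),
  (fun i => if (i < N)%N then B i else B' (i - N)%N).
split.
- by move=> i; case: ifP.
- by move=> i; case: ifP.
- apply/seteqP; split => [p [Bp Bp'] i iN /=|p Bp].
    case: ifPn => [|]; first exact: Bp.
    by rewrite -leqNgt => Ni; apply: Bp'; rewrite ltn_subLR.
  split => i iN.
    by have := Bp i (ltn_addr _ iN); rewrite iN.
  have := Bp (N + i)%N; rewrite ltn_add2l => /(_ iN).
  by rewrite ltnNge leq_addr/= addnC addnK.
Qed.

(** The times of a cylinder come in any order and may repeat, while independence is stated along
    nondecreasing grids. Sorting the times together with 0 gives a grid whose increments determine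
    every [p (r i) - p 0]. *)
Lemma nondecreasing_enumeration (N : nat) (r : nat -> R) :
  (forall i, 0 <= r i) ->
  exists u : nat -> R, [/\ u 0%N = 0, forall i, u i <= u i.+1
    & forall i, (i < N)%N -> exists2 k, (k <= N)%N & u k = r i].
Proof.
move=> r0; pose s0 := sort <=%R (0 :: [seq r i | i <- iota 0 N]).
have ss0 : size s0 = N.+1 by rewrite size_sort /= size_map size_iota.
have sorteds0 : sorted <=%R s0 by exact: (sort_sorted (@le_total _ _)).
have lenth i j : (i <= j)%N -> (j <= N)%N -> s0`_i <= s0`_j.
  move=> ij jN; apply: (sorted_leq_nth le_trans (@lexx _ _)) => //.
  - by rewrite inE ss0 ltnS (leq_trans ij).
  - by rewrite inE ss0 ltnS.
have mems0 x : x \in s0 -> 0 <= x.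
  rewrite mem_sort inE => /orP[/eqP -> //|/mapP[i _ ->]]; exact: r0.
(* Beyond the last entry the index is frozen at [N]: the default value 0 of [nth] would break
   monotonicity there. *)
exists (fun i => s0`_(minn i N)); split => [|i|i iN].
- rewrite min0n; apply/eqP; rewrite eq_le; apply/andP; split.
    have : 0 \in s0 by rewrite mem_sort inE eqxx.
    move=> zs; rewrite -[leRHS](nth_index 0 zs); apply: lenth => //.
    by rewrite -ltnS -ss0 index_mem.
  by apply: mems0; apply: mem_nth; rewrite ss0.
- by apply: lenth; rewrite ?geq_minr// leq_min geq_minr geq_min leqnSn.
- have ri : r i \in s0.
    rewrite mem_sort inE; apply/orP; right; apply/mapP; exists i => //.
    by rewrite mem_iota.
  have : (index (r i) s0 <= N)%N by rewrite -ltnS -ss0 index_mem.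
  by move=> iN'; exists (index (r i) s0) => //; rewrite (minn_idPl _)// nth_index.
Qed.

(* A cylinder is measurable for the increments over the finite grid of its times, and
   rectangles of increments form a pi-system. *)
Let cylinder_law (s s' : R) C : cylinders [set r | 0 <= r] C ->
  P (path_from w s @^-1` C) = P (path_from w s' @^-1` C).
Proof.
move=> [N [r [B [r0 mB ->]]]].
have [u [u0 uS ur]] := @nondecreasing_enumeration N r r0.
apply: (@eq_law_generated _ _ _ P _ (increment_sets u N) (path_from w s)
  (path_from w s')) => //.
- by move=> A; exact: increment_law.
- pose T := g_sigma_algebraType (increment_sets u N).
  rewrite (_ : mkset _ = \bigcap_(i in [set i | (i < N)%N])
     ((fun p : T => p (r i) - p 0) @^-1` B i)); last by apply/seteqP; split.
  apply: (@bigcap_measurableType _ T) => // i iN; rewrite -[X in measurable X]setTI.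
  have [k kN uk] := ur _ iN.
  suff : measurable_fun setT (fun p : T => p (r i) - p 0) by exact.
  rewrite -uk -u0.
  apply: (eq_measurable_fun (fun p : T => \sum_(j < k) (p (u j.+1) - p (u j)))).
    move=> p _; rewrite -(big_mkord xpredT (fun j => p (u j.+1) - p (u j))).
    by rewrite telescope_sumr.
  apply: measurable_sum => j; apply: measurable_increment.
  exact: leq_trans kN.
Qed.

(** Coordinate sets are not stable under intersection; finite cylinders are, and they generate the
    same sigma-algebra. *)
Lemma path_law (s s' : R) (C : set (path_space [set r : R | 0 <= r])) :
  measurable C -> P (path_from w s @^-1` C) = P (path_from w s' @^-1` C).
Proof.
move=> mC; pose D : set R := [set r | 0 <= r].
have cC : <<s cylinders D >> C.
  move: C mC; apply: smallest_sub; first exact: smallest_sigma_algebra.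
  move=> _ [r [B [Dr mB ->]]]; apply: sub_sigma_algebra.
  exists 1%N, (fun=> r), (fun=> B); split => //.
  by apply/seteqP; split => p /= Bp; [|exact: (Bp 0%N)].
have cylinder_path A : cylinders D A ->
    (measurable : set (set (path_space D))) A.
  move=> [N [r [B [Dr mB ->]]]].
  rewrite (_ : mkset _ = \bigcap_(i in [set i | (i < N)%N])
     ((fun p : path_space D => p (r i) - p 0) @^-1` B i));
    last by apply/seteqP; split.
  apply: (@bigcap_measurableType _ (path_space D)) => // i iN.
  by rewrite -[X in measurable X]setTI; exact: measurable_coord.
have mp t : measurable_fun setT
    (path_from w t : Omega -> g_sigma_algebraType (cylinders D)).
  apply: (@measurability _ _ _
    (g_sigma_algebraType (cylinders D)) _ _ (cylinders D)) => //.
  move=> _ [A cA <-]; apply: (@measurable_path_from D) => //.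
  exact: cylinder_path.
apply: (@eq_law_generated _ _ _ P _ (cylinders D) (path_from w s)
  (path_from w s')) => //.
by move=> A; exact: cylinder_law.
Qed.

End path_law.

(** * Adapted variables as functionals of the path *)

Lemma ae_forall_countable {d} {T : measurableType d} {R : realType}
    (mu : {measure set T -> \bar R}) (I : countType) (Q : I -> T -> Prop) :
  (forall i, {ae mu, forall x, Q i x}) -> {ae mu, forall x, forall i, Q i x}.
Proof.
move=> aeQ.
have : {ae mu, forall x, forall n : nat,
    (if unpickle n is Some i then Q i else fun=> True) x}.
  by apply: ae_foralln => n; case: unpickle => [i|] //; apply/aeW.
by apply: filterS => x Qx i; have := Qx (pickle i); rewrite pickleK.
Qed.

Section filtration.
Context {d : measure_display} {Omega : measurableType d} {R : realType}.
Variable P : probability Omega R.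
Variable w : R -> Omega -> R.
Hypothesis w_wiener : is_wiener P w.

Lemma measurable_path_spaceS (D D' : set R) (C : set (R -> R)) : D `<=` D' ->
  (measurable : set (set (path_space D))) C ->
  (measurable : set (set (path_space D'))) C.
Proof.
move=> DD'; move: C; apply: smallest_sub; first exact: smallest_sigma_algebra.
move=> _ [r [B [Dr mB ->]]]; apply: sub_sigma_algebra; exists r, B.
by split => //; exact: DD'.
Qed.

(** Generation of sigma-algebras commutes with preimages, so the sigma-algebra of the driver on
    [[s, t]] is pulled back from path space along [path_from w s]. Times become elapsed times, which
    makes different starting times comparable. *)
Lemma filtration_fromP (s t : R) (A : set Omega) :
  filtration_from P w s t A <-> measurable A /\
  exists2 C : set (path_space [set r | 0 <= r <= t - s]), measurable C &
    P.-negligible (A `+` (path_from w s @^-1` C)).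
Proof.
pose D : set R := [set r | 0 <= r <= t - s].
have genE : [set C | exists r (B : set R), [/\ s <= r <= t, measurable B
      & C = wiener_from w s r @^-1` B]] =
    preimage_set_system setT (path_from w s) (coord_sets D).
  apply/seteqP; split => [C [r [B [rst mB ->]]]|C [_ [r [B [Dr mB ->]]]] <-].
    exists [set p | B (p (r - s) - p 0)].
      by exists (r - s), B; split => //; rewrite /D/=; lra.
    rewrite setTI; apply/seteqP; split => om;
      by rewrite /preimage /path_from /wiener_from/= addr0 (addrC s) subrK.
  exists (s + r), B; split => //; first by move: Dr; rewrite /D/=; lra.
  rewrite setTI; apply/seteqP; split => om;
    by rewrite /preimage /path_from /wiener_from/= addr0.
rewrite /filtration_from/= genE g_sigma_preimageE.
split=> [[mA [_ [C mC <-] nC]]|[mA [C mC nC]]]; split => //.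
  by exists C => //; rewrite setTI in nC.
by exists (path_from w s @^-1` C) => //; exists C => //; rewrite setTI.
Qed.

(* The functional takes at [p] the infimum of the rationals [q] such that [p] lies in
   the path event representing [Z < q]. *)
Lemma doob_dynkin_ae (s t : R) (Z : Omega -> R) :
  (forall B : set R, measurable B -> filtration_from P w s t (Z @^-1` B)) ->
  exists Zh : path_space [set r | 0 <= r <= t - s] -> R,
    measurable_fun setT Zh /\
    {ae P, forall omega, Z omega = Zh (path_from w s omega)}.
Proof.
pose D : set R := [set r | 0 <= r <= t - s]; move=> FZ.
have /choice[C CP] : forall q : rat, exists C : set (path_space D),
    measurable C /\
    P.-negligible (Z @^-1` `]-oo, ratr q[ `+` (path_from w s @^-1` C)).
  move=> q; have mq : measurable (`]-oo, ratr q[ : set R).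
    exact: measurable_itv.
  have /filtration_fromP[_ [C mC nC]] := FZ _ mq.
  by exists C.
pose Ze (p : path_space D) : \bar R :=
  ereal_inf [set (ratr q)%:E | q in [set q | C q p]].
have mZe : measurable_fun setT Ze.
  apply: (@measurability _ _ _ _ _ _ _ (ErealGenInftyO.measurableE R)).
  move=> _ [_ [c ->] <-]; rewrite setTI.
  rewrite (_ : _ @^-1` _ =
      \bigcup_(q in [set q : rat | ratr q < c]) C q).
    rewrite bigcup_mkcond; apply: bigcupT_measurable_rat => q.
    by case: ifP => // _; exact: (CP q).1.
  apply/seteqP; split => p /=.
    rewrite in_itv/= => /ereal_inf_lt[_ [q Cq <-]]; rewrite lte_fin => qc.
    by exists q.
  move=> [q /= qc Cq]; rewrite in_itv/=; apply: (@le_lt_trans _ _ (ratr q)%:E).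
    by apply: ereal_inf_lbound; exists q.
  by rewrite lte_fin.
(* [Ze] may be infinite on paths where the events [C q] are not those of a real number; [fine] gives
   the value 0 there, outside the almost sure event below. *)
exists (fine \o Ze); split.
  exact: measurableT_comp mZe.
have : {ae P, forall omega, forall q : rat,
    (Z omega < ratr q)%R <-> C q (path_from w s omega)}.
  apply: ae_forall_countable => q.
  have [N [mN PN0 NS]] := (CP q).2; exists N; split => //.
  apply: subset_trans NS => om /= nZC.
  have [Zq|Zq] := boolP (Z om < ratr q).
    by left; split; [rewrite in_itv|move=> Cq; apply: nZC].
  right; split; last by rewrite in_itv/=; exact/negP.
  by apply: contrapT => nCq; apply: nZC; split => //; rewrite (negbTE Zq).
apply: filterS => om ZC /=; rewrite /Ze.
suff -> : ereal_inf [set (ratr q)%:E | q in [set q | C q (path_from w s om)]]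
  = (Z om)%:E by [].
apply/eqP; rewrite eq_le; apply/andP; split.
  apply/lee_addgt0Pr => e e0.
  have Zlt : Z om < Z om + e by rewrite ltrDl.
  have [q qZ] := rat_in_itvoo Zlt; move: qZ; rewrite in_itv/= => /andP[Zq qZ].
  apply: (@le_trans _ _ (ratr q)%:E); last by rewrite -EFinD lee_fin ltW.
  by apply: ereal_inf_lbound; exists q => //; apply/ZC.
apply: le_ereal_inf_tmp => _ [q /ZC Zq <-].
by rewrite lee_fin ltW.
Qed.

End filtration.

(** * Absorbed paths and their rational skeletons *)

Section rat_below.
Context {R : realType}.

(** Explicit rationals converging to [u], each nondecreasing and hence measurable in [u]. They serve
    both to extend a path from the rationals and to obtain joint measurability. *)
Definition rat_below (k : nat) (u : R) : rat :=
  (Num.floor (u * k.+1%:R))%:~R / k.+1%:R.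

Lemma ratr_rat_below k (u : R) :
  ratr (rat_below k u) = (Num.floor (u * k.+1%:R))%:~R / k.+1%:R :> R.
Proof. by rewrite /rat_below fmorph_div/= ratr_int ratr_nat. Qed.

Lemma rat_below_le k (u : R) : ratr (rat_below k u) <= u.
Proof. by rewrite ratr_rat_below ler_pdivrMr// floor_le. Qed.

Lemma rat_below_gt k (u : R) : u < ratr (rat_below k u) + k.+1%:R^-1.
Proof.
rewrite ratr_rat_below -[X in _ + X]mul1r -mulrDl ltr_pdivlMr//.
by have := floorD1_gt (u * k.+1%:R); rewrite intrD.
Qed.

Lemma rat_below_cvg (u : R) : (ratr (rat_below k u) : R) @[k --> \oo] --> u.
Proof.
apply/cvgrPdist_le => e e0.
near=> k.
rewrite ger0_norm ?subr_ge0 ?rat_below_le//.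
have := rat_below_gt k u; rewrite -ltrBlDl => /ltW /le_trans; apply.
apply: ltW; near: k; exact: (near_infty_natSinv_lt (PosNum e0)).
Unshelve. all: by end_near. Qed.

End rat_below.

Section paths.
Context {R : realType}.

Lemma dist_max0 (u u' : R) : `|Num.max 0 u - Num.max 0 u'| <= `|u - u'|.
Proof.
rewrite /Num.max; case: ltP => u0; case: ltP => u0';
  rewrite ?subrr ?normr0// ?sub0r ?subr0 ?normrN.
- by rewrite !ger0_norm// ?subr_ge0; lra.
- by rewrite distrC !ger0_norm// ?subr_ge0; lra.
Qed.

Lemma uniform_continuity_segment (v : R -> R) (N e : R) : continuous v -> 0 < e ->
  exists k : nat, forall y y' : R, `|y| <= N -> `|y - y'| < k.+1%:R^-1 ->
    `|v y - v y'| < e.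
Proof.
move=> cv e0; have e20 : 0 < e / 2 by rewrite divr_gt0.
have : \forall k \near \oo, `[(- N)%R, N] `<=` (fun y => forall y' : R,
    `|y - y'| < k.+1%:R^-1 -> `|v y - v y'| < e).
  apply: (proj1 (compact_near_coveringP _) (@segment_compact R (- N) N)) => x _.
  have /cvgrPdist_lt /(_ _ e20) /nbhs_ballP[eta /= eta0 veta] := cv x.
  have eta20 : 0 < eta / 2 by rewrite divr_gt0.
  exists (ball x (eta / 2), [set k : nat | k.+1%:R^-1 < eta / 2]) => /=.
    split; first exact: nbhsx_ballx.
    exact: (near_infty_natSinv_lt (PosNum eta20)).
  move=> [y k] /= [xy keta] y' yy'.
  have xy1 : `|v x - v y| < e / 2.
    by apply: veta; rewrite /ball/=; apply: (lt_trans xy); lra.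
  have xy2 : `|v x - v y'| < e / 2.
    apply: veta; rewrite /ball/= (splitr eta).
    rewrite (_ : x - y' = (x - y) + (y - y')); last by ring.
    by apply: le_lt_trans (ler_normD _ _) _; rewrite ltrD// (lt_trans yy').
  rewrite (splitr e) (_ : v y - v y' = (v x - v y') - (v x - v y)); last by ring.
  by apply: le_lt_trans (ler_normB _ _) _; rewrite ltrD.
move=> [k _ /(_ k (leqnn _)) H]; exists k => y y' yN.
by apply: H; rewrite /= in_itv/= -ler_norml.
Qed.

(* A solution together with its lifetime is one continuous path absorbed at 0: it is
   alive exactly where it is positive.  The path is extended by [x] to negative
   times. *)
Definition absorbed_path (x : R) (v : R -> R) :=
  [/\ continuous v, forall u, 0 <= v u, forall u, u <= 0 -> v u = x
    & forall u u', u <= u' -> v u = 0 -> v u' = 0].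

(* Countably many conditions, hence a measurable set of paths, which characterise the
   restrictions of absorbed paths to the rationals. *)
Definition regular_skeleton (x : R) (z : rat -> R) :=
  [/\ forall q, 0 <= z q, forall q, q <= 0 -> z q = x,
      forall N m : nat, exists k : nat, forall q q' : rat, `|q| <= N%:R ->
        `|q - q'| < k.+1%:R^-1 -> `|z q - z q'| <= m.+1%:R^-1
    & forall q', z q' = 0 \/ exists m : nat, forall q, q <= q' ->
        m.+1%:R^-1 <= z q].

(** For the last clause: a path alive at [q'] is positive on all of [[0, q']] by absorption, hence
    bounded away from 0 there by compactness; before time 0 it equals [x]. *)
Lemma absorbed_path_skeleton x v : 0 < x -> absorbed_path x v ->
  regular_skeleton x (fun q => v (ratr q)).
Proof.
move=> x0 [cv v0 vx va]; split => //.
- by move=> q q0; rewrite vx// lerq0.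
- move=> N m; have m0 : 0 < m.+1%:R^-1 :> R by rewrite invr_gt0.
  have [k kP] := @uniform_continuity_segment v N%:R _ cv m0.
  exists k => q q' qN qq'; apply/ltW/kP.
    by rewrite -ratr_norm -(ratr_nat R) ler_rat.
  by rewrite -rmorphB/= -ratr_norm -(ratr_nat R) -fmorphV/= ltr_rat.
- move=> q'; have [->|vq'] := eqVneq (v (ratr q')) 0; [by left|right].
  have vpos u : u <= ratr q' -> 0 < v u.
    move=> uq'; rewrite lt_neqAle v0 andbT eq_sym; apply: contra_neq vq'.
    exact: va.
  have [q'0|q'0] := leP q' 0.
    have [m mx] := near_infty_natSinv_lt (PosNum x0).
    move=> /(_ m (leqnn _)) /= mx'; exists m => q qq'.
    by rewrite vx; [exact: ltW|rewrite lerq0 (le_trans qq')].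
  have q'0R : 0 <= ratr q' :> R by rewrite ler0q ltW.
  have [c] := @EVT_min R v 0 (ratr q') q'0R (continuous_subspaceT cv).
  rewrite in_itv/= => /andP[c0 cq'] cmin.
  have mx0 : 0 < Num.min x (v c) by rewrite lt_min x0 vpos.
  have [m _ /(_ m (leqnn _)) /= mlt] := near_infty_natSinv_lt (PosNum mx0).
  move: mlt; rewrite lt_min => /andP[mx mc]; exists m => q qq'.
  have [q0|q0] := leP q 0; first by rewrite vx ?lerq0//; exact: ltW.
  apply: (le_trans (ltW mc)); apply: cmin.
  by rewrite in_itv/= ler0q ltW//= ler_rat.
Qed.

(** Absorption stated on the rationals alone would not pass to the extension, which could touch 0 at
    an irrational time and leave again. The uniform positive lower bound before a time of life
    excludes this. *)
Lemma skeleton_extension x z : 0 < x -> regular_skeleton x z ->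
  exists2 v, absorbed_path x v &
    forall u : R, z (rat_below k u) @[k --> \oo] --> v u.
Proof.
move=> x0 [z0 zx zu za].
have rbN (u : R) (N : nat) k : `|u| + 1 <= N%:R -> `|rat_below k u| <= N%:R.
  move=> uN; rewrite -(ler_rat R) ratr_norm ratr_nat.
  have := rat_below_le k u; have := rat_below_gt k u.
  have : k.+1%:R^-1 <= 1 :> R by rewrite invf_le1// ler1n.
  have /andP[] : - `|u| <= u <= `|u| by rewrite -ler_norml.
  move: uN; rewrite ler_norml; move: (ratr _) (_^-1) `|u| => a b c *; lra.
have diff_lt (a a' t t' c c' e : R) : a <= t -> t < a + c -> a' <= t' ->
    t' < a' + c' -> c < e -> c' < e -> - (e + e) < (a - t) - (a' - t') < e + e.
  by move=> *; lra.
have near_rb (u u' : R) (l : nat) : `|u - u'| < l.+1%:R^-1 ->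
    \forall k & k' \near \oo, `|rat_below k u - rat_below k' u'| < l.+1%:R^-1.
  move=> uu'; pose e : R := (l.+1%:R^-1 - `|u - u'|) / 2.
  have e0 : 0 < e by rewrite divr_gt0// subr_gt0.
  have ne := near_infty_natSinv_lt (PosNum e0).
  exists ([set k : nat | k.+1%:R^-1 < e], [set k : nat | k.+1%:R^-1 < e]) => //.
  move=> [k k'] /= [ke k'e].
  rewrite -(ltr_rat R) ratr_norm rmorphB/= fmorphV/= ratr_nat.
  have e2 : e + e = l.+1%:R^-1 - `|u - u'| by rewrite /e -splitr.
  rewrite (_ : ratr (rat_below k u) - ratr (rat_below k' u') = (u - u') +
    ((ratr (rat_below k u) - u) - (ratr (rat_below k' u') - u'))); last by ring.
  apply: le_lt_trans (ler_normD _ _) _.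
  by rewrite -ltrBrDl -e2 ltr_norml; move: (rat_below_le k u) (rat_below_gt k u)
    (rat_below_le k' u') (rat_below_gt k' u') ke k'e; exact: diff_lt.
have exN (u : R) : exists N : nat, `|u| + 1 <= N%:R.
  by exists (Num.truncn (`|u| + 1)).+1; apply/ltW/truncnS_gt.
have cvz (u : R) : cvgn (fun k => z (rat_below k u)).
  apply/cauchy_cvgP/cauchy_ballP => e e0; near_simpl.
  have [N uN] := exN u.
  have [m _ /(_ m (leqnn _)) /= me] := near_infty_natSinv_lt (PosNum e0).
  have [l lP] := zu N m.
  have : `|u - u| < l.+1%:R^-1 by rewrite subrr normr0 invr_gt0.
  move=> /near_rb; apply: filterS => -[k k'] /= kk'.
  by rewrite /ball/=; apply: le_lt_trans me; apply: lP kk'; exact: rbN.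
pose v (u : R) := limn (fun k => z (rat_below k u)).
have zv (u : R) : z (rat_below k u) @[k --> \oo] --> v u by exact: cvz.
have vu N m : exists k : nat, forall u u' : R, `|u| + 1 <= N%:R ->
    `|u - u'| < k.+1%:R^-1 -> `|v u - v u'| <= m.+1%:R^-1.
  have [l lP] := zu N m; exists l => u u' uN uu'.
  have : `|z (rat_below k u) - z (rat_below k u')| @[k --> \oo] --> `|v u - v u'|.
    by apply: cvg_norm; exact: cvgB.
  move/cvgr_to_le; apply.
  have := near_rb _ _ _ uu'; move=> [[A B] /= [nA nB] AB].
  near=> k; apply: lP; first exact: rbN.
  by apply: (AB (k, k)); split; near: k.
exists v => //; split.
- move=> u; apply/cvgrPdist_le => e e0; have [N uN] := exN u.
  have [m _ /(_ m (leqnn _)) /= me] := near_infty_natSinv_lt (PosNum e0).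
  have [l lP] := vu N m.
  apply/nbhs_ballP; exists l.+1%:R^-1 => /=; first by rewrite invr_gt0.
  by move=> u' uu'; apply: le_trans (ltW me); exact: lP.
- by move=> u; apply: (cvgr_to_ge (zv u)); exact: nearW.
- move=> u u0; suff : z (rat_below k u) @[k --> \oo] --> x.
    by move/(cvg_unique _ (zv u)) => ->.
  rewrite (_ : (fun _ => _) = cst x); first exact: cvg_cst.
  apply/funext => k; rewrite zx// -(ler_rat R) rmorph0.
  by rewrite (le_trans (rat_below_le _ _)).
- move=> u u' uu' vu0; apply/eqP; apply: contraT => vu'0.
  have vu'pos : 0 < v u'.
    rewrite lt_neqAle eq_sym vu'0/=.
    by apply: (cvgr_to_ge (zv u')); exact: nearW.
  have [N u'N] := exN u'.
  have vu'2 : 0 < v u' / 2 by rewrite divr_gt0.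
  have [m _ /(_ m (leqnn _)) /= me] := near_infty_natSinv_lt (PosNum vu'2).
  have [l lP] := vu N m.
  have l0 : 0 < l.+1%:R^-1 :> R by rewrite invr_gt0.
  (* The approximants come from below and never exceed their limit. Positivity is therefore carried
     to a rational [q] beyond [u'], whose approximants eventually lie beyond [u'] and thus beyond
     all approximants of [u]. *)
  have [q] := @rat_in_itvoo R u' (u' + l.+1%:R^-1) ltac:(by rewrite ltrDl).
  rewrite in_itv/= => /andP[u'q qu'].
  have vq : 0 < v (ratr q).
    have d : - l.+1%:R^-1 < u' - ratr q < l.+1%:R^-1.
      by move: u'q qu' l0; move: (ratr q) (l.+1%:R^-1) => a c *; lra.
    rewrite -ltr_norml in d.
    have := le_lt_trans (lP _ _ u'N d) me.
    rewrite ltr_norml; move: vu'pos; move: (v u') (v (ratr q)) => a c *; lra.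
  have nz : \forall k \near \oo, 0 < z (rat_below k (ratr q : R)).
    by apply: (cvgr_gt _ (zv (ratr q))); exact: vq.
  have nk : \forall k \near \oo, u' < ratr (rat_below k (ratr q : R)).
    by apply: (cvgr_gt _ (@rat_below_cvg R _)).
  have [k [zk0 ku']] : exists k, 0 < z (rat_below k (ratr q : R)) /\
      u' < ratr (rat_below k (ratr q : R)).
    by have [k []] := filter_ex (filterI nz nk); exists k.
  have [zk|[j jP]] := za (rat_below k (ratr q : R)); first by rewrite zk ltxx in zk0.
  have : j.+1%:R^-1 <= v u.
    apply: (cvgr_to_ge (zv u)); apply: nearW => i; apply: jP.
    rewrite -(ler_rat R) (le_trans (rat_below_le _ _))// (le_trans uu')//.
    exact: ltW.
  by rewrite vu0 leNgt invr_gt0 ltr0Sn.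
Unshelve. all: by end_near. Qed.

End paths.

Section measurable_countable.
Context {d : measure_display} {T : measurableType d}.

Lemma measurable_forall (I : countType) (Q : I -> T -> Prop) :
  (forall i, measurable [set x | Q i x]) -> measurable [set x | forall i, Q i x].
Proof.
move=> mQ; rewrite (_ : mkset _ = ~` \bigcup_i ~` [set x | Q i x]).
  apply/measurableC/countable_bigcupT_measurable => // i.
  exact/measurableC/mQ.
rewrite setC_bigcup; apply/seteqP; split => [x Qx i _ nQ|x Qx i].
  exact/nQ/Qx.
by apply: contrapT; exact: Qx.
Qed.

Lemma measurable_exists (I : countType) (Q : I -> T -> Prop) :
  (forall i, measurable [set x | Q i x]) -> measurable [set x | exists i, Q i x].
Proof.
move=> mQ; rewrite (_ : mkset _ = \bigcup_i [set x | Q i x]).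
  exact: countable_bigcupT_measurable.
by apply/seteqP; split => x /= [i]; exists i.
Qed.

Lemma measurable_imply_cst (A : Prop) (Q : T -> Prop) :
  measurable [set x | Q x] -> measurable [set x | A -> Q x].
Proof.
move=> mQ; have [a|na] := pselect A.
  rewrite (_ : mkset _ = [set x | Q x])//.
  by apply/seteqP; split => x /=; [apply|].
rewrite (_ : mkset _ = setT)//; apply/seteqP; split => // x _ /na //.
Qed.

End measurable_countable.

Section joint.
Context {d : measure_display} {T : measurableType d} {R : realType}.

(** Rounding the time down to a rational yields a countable gluing of sections at fixed times;
    continuity in time gives the limit. *)
Lemma measurable_joint (V : T -> R -> R) :
  (forall u, measurable_fun setT (V ^~ u)) -> (forall z, continuous (V z)) ->
  measurable_fun setT (fun zu : T * R => V zu.1 zu.2).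
Proof.
move=> mV cV.
apply: (@measurable_fun_cvg _ _ _ _
  (fun k (zu : T * R) => V zu.1 (ratr (rat_below k zu.2)))); last first.
  by move=> [z u] _ /=; apply: (cvg_comp _ _ (@rat_below_cvg R u)); exact: cV.
move=> k _ B mB; rewrite setTI.
rewrite (_ : _ @^-1` B = \bigcup_(q : rat) ([set z | B (V z (ratr q))] `*`
    [set u : R | ratr (rat_below k u) = ratr q :> R])).
  apply: bigcupT_measurable_rat => q; apply: measurableX.
    by rewrite -[X in measurable X]setTI; exact: mV.
  have mr : measurable_fun setT (fun u : R => ratr (rat_below k u) : R).
    apply: nondecreasing_measurable => // u u' uu'.
    by rewrite !ratr_rat_below ler_pM2r// ler_int le_floor// ler_pM2r.
  rewrite -[X in measurable X]setTI.
  exact: (mr measurableT [set ratr q]).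
apply/seteqP; split => [[z u] /= Bu|[z u] [q _ [/= Bq uq]]]; last by rewrite uq.
by exists (rat_below k u).
Qed.

Lemma measurable_regular_skeleton (x : R) (Z : rat -> T -> R) :
  (forall q, measurable_fun setT (Z q)) ->
  measurable [set p | regular_skeleton x (Z ^~ p)].
Proof.
move=> mZ.
have mset (F : T -> R) (B : set R) : measurable_fun setT F -> measurable B ->
    measurable [set p | B (F p)].
  by move=> mF mB; rewrite -[X in measurable X]setTI; exact: mF.
pose A1 := [set p | forall q, 0 <= Z q p].
pose A2 := [set p | forall q, q <= 0 -> Z q p = x].
pose A3 := [set p | forall N m : nat, exists k : nat, forall q q' : rat,
  `|q| <= N%:R -> `|q - q'| < k.+1%:R^-1 -> `|Z q p - Z q' p| <= m.+1%:R^-1].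
pose A4 := [set p | forall q', Z q' p = 0 \/ exists m : nat, forall q, q <= q' ->
        m.+1%:R^-1 <= Z q p].
have mA1 : measurable A1.
  apply: measurable_forall => q.
  by apply: (mset (Z q) [set y | 0 <= y]) => //; rewrite -set_itvcy.
have mA2 : measurable A2.
  apply: measurable_forall => q; apply: measurable_imply_cst.
  exact: (mset (Z q) [set x]).
have mA3 : measurable A3.
  do 2 apply: measurable_forall => ?; apply: measurable_exists => ?.
  apply: measurable_forall => q; apply: measurable_forall => q'.
  do 2 apply: measurable_imply_cst.
  apply: (mset (fun p => `|Z q p - Z q' p|) [set y | y <= _]) => //.
    apply: measurableT_comp => //; exact: measurable_funB.
  by rewrite -set_itvNyc.
have mA4 : measurable A4.
  apply: measurable_forall => q'.
  apply: (@measurableU _ _ [set p | Z q' p = 0] [set p | exists m : nat,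
    forall q, q <= q' -> m.+1%:R^-1 <= Z q p]).
    exact: (mset (Z q') [set 0]).
  apply: measurable_exists => m; apply: measurable_forall => q.
  apply: measurable_imply_cst.
  by apply: (mset (Z q) [set y | _ <= y]) => //; rewrite -set_itvcy.
rewrite (_ : mkset _ = A1 `&` (A2 `&` (A3 `&` A4))).
  by do 3 (apply: measurableI => //).
by apply/seteqP; split => [p []//|p [? [? []]]].
Qed.

End joint.

Section canonical_path.
Context {d : measure_display} {Omega : measurableType d} {R : realType}.
Variable P : probability Omega R.
Variable w : R -> Omega -> R.
Hypothesis w_wiener : is_wiener P w.
Local Notation paths := (path_space [set r : R | 0 <= r]).

(** Doob-Dynkin is applied at each rational time, and the countably many functionals are
    interpolated. Paths with an irregular skeleton are sent to the constant [x]: the pathwise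
    clauses of [is_strong_solution] concern every [omega], so every path must have an absorbed
    image. *)
Lemma canonical_path (s x : R) (V : Omega -> R -> R) : 0 < x ->
  (forall omega, absorbed_path x (V omega)) ->
  (forall u (B : set R), 0 <= u -> measurable B ->
     filtration_from P w s (s + u) (V ^~ u @^-1` B)) ->
  exists Vb : paths -> R -> R,
    [/\ forall p, absorbed_path x (Vb p),
        forall u, measurable_fun setT (Vb ^~ u)
      & {ae P, forall omega, forall u, Vb (path_from w s omega) u = V omega u}].
Proof.
move=> x0 aV FV.
(* A negative rational is read at time 0, where the adaptedness hypothesis applies and the absorbed
   path has the same value [x]. *)
pose time (q : rat) : R := Num.max 0 (ratr q).
have time0 q : 0 <= time q by rewrite le_max lexx.
have Vtime q omega : V omega (time q) = V omega (ratr q).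
  case: (aV omega) => _ _ Vx _; rewrite /time.
  by case: leP => // q0; rewrite !Vx// ltW.
have /choice[Z ZP] (q : rat) : exists Zq : paths -> R, measurable_fun setT Zq /\
    {ae P, forall omega, V omega (ratr q) = Zq (path_from w s omega)}.
  have FVq B : measurable B -> filtration_from P w s (s + time q)
      ((fun omega => V omega (time q)) @^-1` B) by exact: FV.
  have [Zq [mZq aeZq]] := doob_dynkin_ae FVq.
  exists Zq; split.
    move=> _ B mB; rewrite setTI.
    apply: (@measurable_path_spaceS R [set r | 0 <= r <= s + time q - s]); last first.
      have := mZq measurableT B mB; rewrite setTI; exact.
    by move=> r /= /andP[].
  by apply: filterS aeZq => omega; rewrite Vtime.
pose C := [set p | regular_skeleton x (Z ^~ p)].
have mC : measurable C by apply: measurable_regular_skeleton => q; exact: (ZP q).1.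
have ext (p : paths) : exists v, absorbed_path x v /\
    forall u : R, (if p \in C then Z (rat_below k u) p else x) @[k --> \oo] --> v u.
  have [pC|pC] := boolP (p \in C).
    by have := pC; rewrite inE => /(skeleton_extension x0)[v av zv]; exists v.
  exists (cst x); split; last by move=> u; exact: cvg_cst.
  split => //; first by move=> u; exact: cvg_cst.
  - by move=> u; exact: ltW.
have /choice[Vb VbP] := ext.
exists Vb; split => [p|u|].
- exact: (VbP p).1.
- apply: (@measurable_fun_cvg _ _ _ _
    (fun k p => if p \in C then Z (rat_below k u) p else x)); last first.
    by move=> p _; exact: (VbP p).2.
  move=> k; apply: measurable_fun_ifT => //.
    apply: (measurable_fun_bool true); rewrite setTI.
    by rewrite preimage_mem_true.
  exact: (ZP _).1.
- have := ae_forall_countable (fun q => (ZP q).2).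
  apply: filterS => omega VZ u.
  have inC : path_from w s omega \in C.
    rewrite inE /C/=.
    have := absorbed_path_skeleton x0 (aV omega).
    by congr (regular_skeleton x _); apply/funext => q; exact: VZ.
  have := (VbP (path_from w s omega)).2 u.
  rewrite inC => lim1.
  have lim2 : Z (rat_below k u) (path_from w s omega) @[k --> \oo] --> V omega u.
    rewrite (_ : (fun _ => _) = (fun k => V omega (ratr (rat_below k u)))).
      apply: (cvg_comp _ _ (@rat_below_cvg R u)); case: (aV omega) => cV _ _ _.
      exact: cV.
    by apply/funext => k; rewrite VZ.
  exact: (cvg_unique _ lim1 lim2).
Qed.

End canonical_path.

(** * Transfer of a strong solution to another starting time *)

Section shift.
Context {R : realType}.
Local Notation mu := (@lebesgue_measure R).

Lemma lebesgue_measure_shift (s : R) (A : set R) : measurable A ->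
  pushforward mu ((fun u => s + u) : _ -> measurableTypeR R) A = mu A.
Proof.
have ms : measurable_fun setT ((fun u => s + u) : R -> measurableTypeR R).
  by apply: measurable_funD => //; exact: measurable_cst.
move=> mA; apply/esym/lebesgue_measure_unique => //= _ [[a b]] _ <-.
rewrite /pushforward (_ : _ @^-1` _ = `]a - s, b - s]).
  rewrite !lebesgue_measure_itv/= !lte_fin ltrD2r.
  by rewrite -!EFinB (_ : b - s - (a - s) = b - a)//; ring.
by apply/seteqP; split => u /=; rewrite !in_itv/= ltrBlDl lerBrDl.
Qed.

Lemma ge0_integral_shift (s t : R) (f : R -> \bar R) : measurable_fun setT f ->
  (forall u, (0 <= f u)%E) ->
  (\int[mu]_(u in `[s, t]) f u = \int[mu]_(u in `[0%R, (t - s)%R]) f (s + u)%R)%E.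
Proof.
move=> mf f0.
have ms : measurable_fun setT ((fun u => s + u) : R -> measurableTypeR R).
  by apply: measurable_funD => //; exact: measurable_cst.
rewrite (_ : `[0, t - s] =
    ((fun u => s + u) : _ -> measurableTypeR R) @^-1` `[s, t]); last first.
  by apply/seteqP; split => u /=; rewrite !in_itv/= lerBrDl lerDl.
have := @ge0_integral_pushforward _ _ (measurableTypeR R) (measurableTypeR R) R _
  ms mu `[s, t] f.
move=> /(_ (measurable_itv _)) <-; last 2 first.
- exact: measurable_funTS.
- by move=> u _.
by apply: eq_measure_integral => A mA _; exact/esym/lebesgue_measure_shift.
Qed.

Lemma Rintegral_shift (s t : R) (f : R -> R) : measurable_fun setT f ->
  \int[mu]_(u in `[s, t]) f u = \int[mu]_(u in `[0, t - s]) f (s + u).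
Proof.
move=> mf; rewrite /Rintegral integralE [in RHS]integralE.
have mEf : measurable_fun setT (EFin \o f) by exact/measurable_EFinP.
rewrite (ge0_integral_shift _ _ (measurable_funepos mEf) (funepos_ge0 _)).
rewrite (ge0_integral_shift _ _ (measurable_funeneg mEf) (funeneg_ge0 _)).
by congr (fine (_ - _)); apply: eq_integral => u _; rewrite ?funeposE ?funenegE.
Qed.

End shift.

(** * Measurability of the errors in the approximation of the Ito integral *)

Section functionals.
Context {R : realType}.
Local Notation mu := (@lebesgue_measure R).
Variables sigma b : R -> R.
Hypothesis sigma_borel : measurable_fun (`[0, +oo[ : set R) sigma.
Hypothesis b_borel : measurable_fun (`[0, +oo[ : set R) b.

Context {d : measure_display} {T : measurableType d}.

(** This and [integral_error] are the two quantities that vanish in probability in the definition of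
    the Ito integral, in elapsed time and over an abstract [T], so that they can be read on [Omega]
    and on path space alike. *)
Definition squared_distance (H : simple_process (Omega := T) (R := R))
    (V : T -> R -> R) (L : R) (z : T) : \bar R :=
  (\int[mu]_(u in `[0%R, L]) ((simple_val H u z - sigma (V z u)) ^+ 2)%R%:E)%E.

Definition integral_error (D : R -> T -> R)
    (H : simple_process (Omega := T) (R := R)) (V : T -> R -> R) (x L : R) (z : T) : R :=
  `|simple_integral D H z - (V z L - x - \int[mu]_(u in `[0, L]) b (V z u))|.

Section measurability.
Variable V : T -> R -> R.
Hypothesis mV : forall u, measurable_fun setT (V ^~ u).
Hypothesis cV : forall z, continuous (V z).
Hypothesis V0 : forall z u, 0 <= V z u.

Lemma measurable_joint_comp (g : R -> R) :
  measurable_fun (`[0, +oo[ : set R) g ->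
  measurable_fun setT (fun zu : T * R => g (V zu.1 zu.2)).
Proof.
move=> mg; apply: (@measurable_comp _ _ _ _ _ _ (`[0, +oo[ : set R) g setT
  (fun zu : T * R => V zu.1 zu.2)) => //.
  by move=> _ [zu _ <-]/=; rewrite in_itv/= V0.
exact: measurable_joint.
Qed.

Let measurable_indic_time (i : interval R) :
  measurable_fun setT (fun zu : T * R => (\1_[set` i] zu.2 : R)).
Proof.
have mi : measurable_fun setT (\1_[set` i] : R -> R).
  by apply: measurable_indic; exact: measurable_itv.
exact: (measurableT_comp mi measurable_snd).
Qed.

Lemma measurable_simple_val (H : simple_process (Omega := T) (R := R)) :
  (forall i, (i < sp_size H)%N -> measurable_fun setT (sp_coef H i)) ->
  measurable_fun setT (fun zu : T * R => simple_val H zu.2 zu.1).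
Proof.
move=> mH; apply: measurable_sum => i; apply: measurable_funM.
  exact: (measurableT_comp (mH i (ltn_ord i)) measurable_fst).
exact: measurable_indic_time.
Qed.

Lemma measurable_squared_distance (H : simple_process (Omega := T) (R := R)) (L : R) :
  (forall i, (i < sp_size H)%N -> measurable_fun setT (sp_coef H i)) ->
  measurable_fun setT (squared_distance H V L).
Proof.
move=> mH; rewrite /squared_distance.
pose F (zu : T * R) : \bar R :=
  (((simple_val H zu.2 zu.1 - sigma (V zu.1 zu.2)) ^+ 2)%:E * (\1_`[0%R, L] zu.2)%:E)%E.
rewrite (_ : (fun z => _) = fubini_F mu F); last first.
  apply/funext => z; rewrite /fubini_F [LHS]integral_mkcond.
  by apply: eq_integral => u _; rewrite epatch_indic.
apply: measurable_fun_fubini_tonelli_F; last first.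
  by move=> zu; rewrite mule_ge0// lee_fin ?sqr_ge0.
apply: emeasurable_funM; apply/measurable_EFinP.
  apply: measurable_funX; apply: measurable_funB.
    exact: measurable_simple_val.
  exact: measurable_joint_comp.
exact: measurable_indic_time.
Qed.

Lemma measurable_drift_integral (L : R) :
  measurable_fun setT (fun z => \int[mu]_(u in `[0, L]) b (V z u)).
Proof.
rewrite /Rintegral; apply: measurableT_comp => //.
pose B (zu : T * R) := (b (V zu.1 zu.2))%:E.
have mB : measurable_fun setT B by apply/measurable_EFinP; exact: measurable_joint_comp.
have mF (F : T * R -> \bar R) : measurable_fun setT F -> (forall zu, 0 <= F zu)%E ->
    measurable_fun setT (fun z => \int[mu]_(u in `[0%R, L]) F (z, u))%E.
  move=> mF F0; rewrite (_ : (fun z => _) =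
      fubini_F mu (fun zu => F zu * (\1_`[0%R, L] zu.2)%:E)%E); last first.
    apply/funext => z; rewrite /fubini_F [LHS]integral_mkcond.
    by apply: eq_integral => u _; rewrite epatch_indic.
  apply: measurable_fun_fubini_tonelli_F; last first.
    by move=> zu; rewrite mule_ge0// lee_fin.
  apply: emeasurable_funM => //; apply/measurable_EFinP.
  exact: measurable_indic_time.
rewrite (_ : (fun z => _) = (fun z => \int[mu]_(u in `[0%R, L]) B^\+ (z, u)
    - \int[mu]_(u in `[0%R, L]) B^\- (z, u))%E).
  apply: emeasurable_funB; apply: mF => //.
    exact: measurable_funepos.
  exact: measurable_funeneg.
apply/funext => z; rewrite integralE.
by congr (_ - _)%E; apply: eq_integral => u _; rewrite ?funeposE ?funenegE.
Qed.

(** Measurability is asked of the increments of the driver: on [paths] the coordinate [p r] itself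
    is not measurable, because the sigma-algebra only sees [p r - p 0]. *)
Lemma measurable_integral_error (D : R -> T -> R)
    (H : simple_process (Omega := T) (R := R)) (x L : R) :
  (forall i, (i < sp_size H)%N -> measurable_fun setT (sp_coef H i)) ->
  (forall i, (i < sp_size H)%N ->
    measurable_fun setT (fun z => D (sp_knot H i.+1) z - D (sp_knot H i) z)) ->
  measurable_fun setT (integral_error D H V x L).
Proof.
move=> mH mD; apply: measurableT_comp => //; apply: measurable_funB.
  apply: measurable_sum => i; apply: measurable_funM.
    exact: mH.
  exact: mD.
apply: measurable_funB; last exact: measurable_drift_integral.
by apply: measurable_funB.
Qed.

End measurability.

End functionals.

Lemma eq_measure_ae {d} {T : measurableType d} {R : realType}
    (mu : {measure set T -> \bar R}) (A B : set T) :
  measurable A -> measurable B -> {ae mu, forall x, A x <-> B x} -> mu A = mu B.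
Proof.
move=> mA mB [N [mN N0 NS]].
have le_mu (C D : set T) : measurable C -> measurable D ->
    (forall x, ~ N x -> C x -> D x) -> (mu C <= mu D)%E.
  move=> mC mD CD; have -> : mu D = (mu D + mu N)%E by rewrite N0 adde0.
  apply: (@le_trans _ _ (mu (D `|` N))); last exact: measureU2.
  apply: le_measure.
  - exact/mem_set.
  - exact/mem_set/measurableU.
  - by move=> x Cx; have [Nx|nNx] := pselect (N x); [right|left; exact: CD].
have AB x : ~ N x -> (A x <-> B x) by move=> nNx; apply: contrapT => /NS.
apply/eqP; rewrite eq_le; apply/andP; split; apply: le_mu => // x /AB; by case.
Qed.

Section lifetime.
Context {R : realType}.

(** Continuity at the lifetime comes from the left limit 0 required of a solution there;
    [Num.max 0 u] freezes the path at [x] before the start. *)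
Lemma solution_absorbed_path (s x : R) (tau : \bar R) (Y : R -> R) :
  (s%:E < tau)%E -> Y s = x ->
  (forall t, s <= t -> (t%:E < tau)%E -> 0 < Y t) ->
  {within [set t | s <= t /\ (t%:E < tau)%E], continuous Y} ->
  (forall r, tau = r%:E -> Y t @[t --> r^'-] --> 0) ->
  absorbed_path x (fun u =>
    if ((s + Num.max 0 u)%:E < tau)%E then Y (s + Num.max 0 u) else 0).
Proof.
move=> stau Ys Y0 cY limY.
have sm (u : R) : s <= s + Num.max 0 u by rewrite lerDl le_max lexx.
split.
- pose g t := if (t%:E < tau)%E then Y t else 0.
  suff cg t e : s <= t -> 0 < e -> exists2 delta, 0 < delta &
      forall t', s <= t' -> `|t - t'| < delta -> `|g t - g t'| < e.
    move=> u; apply/cvgrPdist_lt => e e0.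
    have [delta delta0 gdelta] := cg _ _ (sm u) e0.
    apply/nbhs_ballP; exists delta => // u'; rewrite /ball/= => uu'.
    apply: gdelta => //; apply: le_lt_trans uu'.
    by rewrite opprD addrACA subrr add0r; exact: dist_max0.
  move=> st e0; have [ttau|taut] := ltP t%:E tau.
    have /subspace_continuousP /(_ t (conj st ttau)) := cY.
    move=> /cvgrPdist_lt /(_ _ e0); rewrite near_withinE => /nbhs_ballP[d1 /= d10 d1P].
    have [d2 d20 d2P] : exists2 d2, 0 < d2 & forall t', t' < t + d2 -> (t'%:E < tau)%E.
      case: tau ttau {stau Y0 cY limY g d1P} => [r||//] /=.
        by rewrite lte_fin => tr; exists (r - t); [lra|move=> t'; rewrite lte_fin; lra].
      by move=> _; exists 1 => // t' _; rewrite ltry.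
    exists (Num.min d1 d2); first by rewrite lt_min d10.
    move=> t' st'; rewrite lt_min => /andP[tt'1 tt'2].
    have t'tau : (t'%:E < tau)%E.
      by apply: d2P; move: tt'2; rewrite ltr_norml; lra.
    by rewrite /g ttau t'tau; apply: d1P.
  have [r taur] : exists r, tau = r%:E.
    case: tau stau taut {Y0 cY limY g} => [r|//|//]; by exists r.
  have /cvgrPdist_lt /(_ _ e0) := limY _ taur.
  rewrite near_withinE => /nbhs_ballP[delta /= delta0 deltaP].
  exists delta => // t' st' tt'.
  rewrite /g (ltNge t%:E) taut/=.
  case: ifPn => [t'tau|]; last by rewrite subrr normr0.
  move: taut t'tau; rewrite taur lee_fin lte_fin => rt t'r.
  apply: deltaP => //; rewrite /ball/=; apply: le_lt_trans tt'.
  by rewrite !ger0_norm ?subr_ge0//; lra.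
- move=> u; case: ifPn => // utau; apply/ltW/Y0 => //.
- by move=> u u0; rewrite max_l// addr0 stau.
- move=> u u' uu'; case: ifPn => [utau|utau _].
    by move=> Yu0; have := Y0 _ (sm u) utau; rewrite Yu0 ltxx.
  rewrite ifF//; apply/negbTE; move: utau; rewrite -!leNgt => /le_trans; apply.
  by rewrite lee_fin lerD2l le_max2.
Qed.

(** The infimum of the empty set is [+oo], so a path that never vanishes has infinite lifetime. *)
Definition lifetime (s : R) (v : R -> R) : \bar R :=
  ereal_inf [set t%:E | t in [set t | s <= t /\ v (t - s) = 0]].

(** Positivity at [t - s] persists on a neighbourhood by continuity, and absorption excludes earlier
    zeros; hence the first zero lies strictly after [t]. *)
Lemma lt_lifetime (s x t : R) (v : R -> R) : absorbed_path x v -> s <= t ->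
  (t%:E < lifetime s v)%E = (0 < v (t - s)).
Proof.
move=> [cv v0 vx va] st; apply/idP/idP => [tl|vt].
  rewrite lt_neqAle v0 andbT eq_sym; apply/eqP => vt0.
  by move: tl; rewrite ltNge => /negP; apply; apply: ereal_inf_lbound; exists t.
have /nbhs_ballP[delta /= delta0 deltaP] : nbhs (t - s) [set u | 0 < v u].
  exact: (cvgr_gt _ (cv (t - s))).
apply: (@lt_le_trans _ _ (t + delta)%:E); first by rewrite lte_fin ltrDl.
apply: le_ereal_inf_tmp => _ [t' [st' vt'] <-]; rewrite lee_fin leNgt.
apply/negP => t't; have [t't2|tt'] := leP t' t.
  have : v (t - s) = 0 by apply: va vt'; lra.
  by move=> vt0; rewrite vt0 ltxx in vt.
suff : 0 < v (t' - s) by rewrite vt' ltxx.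
by apply: deltaP; rewrite /ball/= ltr0_norm; lra.
Qed.

Lemma lifetime_pathwise (s x : R) (v : R -> R) : 0 < x -> absorbed_path x v ->
  [/\ (s%:E < lifetime s v)%E, v (s - s) = x,
      forall t, s <= t -> (t%:E < lifetime s v)%E -> 0 < v (t - s),
      {within [set t | s <= t /\ (t%:E < lifetime s v)%E],
         continuous (fun t => v (t - s))}
    & forall r, lifetime s v = r%:E -> v (t - s) @[t --> r^'-] --> 0].
Proof.
move=> x0 av; have [cv v0 vx va] := av.
have cvs : continuous (fun t => v (t - s)).
  move=> t; apply: (continuous_comp (f := fun t => t - s)); last exact: cv.
  by apply: cvgB; [exact: cvg_id|exact: cvg_cst].
split.
- by rewrite (lt_lifetime av)// subrr vx.
- by rewrite subrr vx.
- by move=> t st; rewrite (lt_lifetime av).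
- exact: continuous_subspaceT.
- move=> r lr; have sr : s < r.
    by rewrite -lte_fin -lr (lt_lifetime av)// subrr vx.
  have <- : v (r - s) = 0.
    apply/eqP; rewrite eq_le v0 andbT leNgt -(lt_lifetime av) ?ltW//.
    by rewrite lr ltxx.
  exact/cvg_at_left_filter/cvs.
Qed.

End lifetime.

Section error_events.
Context {d : measure_display} {Omega : measurableType d} {R : realType}.
Local Notation mu := (@lebesgue_measure R).
Variables sigma b : R -> R.
Hypothesis sigma_borel : measurable_fun (`[0, +oo[ : set R) sigma.
Hypothesis b_borel : measurable_fun (`[0, +oo[ : set R) b.

Definition shift_process (s : R) (H : simple_process (Omega := Omega) (R := R)) :=
  SimpleProcess (sp_size H) (fun i => sp_knot H i - s) (sp_coef H).

Lemma simple_val_shift s (H : simple_process (Omega := Omega) (R := R)) u omega :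
  simple_val H (s + u) omega = simple_val (shift_process s H) u omega.
Proof.
apply: eq_bigr => i _; congr (_ * _); rewrite !indicE; congr (nat_of_bool _)%:R.
by apply/idP/idP; rewrite !inE/= !in_itv/= ltrBlDl lerBrDl.
Qed.

Variables (V : Omega -> R -> R) (tau : Omega -> \bar R) (Y : R -> Omega -> R).
Variables (s x : R).
Hypothesis aV : forall omega, absorbed_path x (V omega).
Hypothesis tauV : forall omega t, s <= t ->
  (t%:E < tau omega)%E = (0 < V omega (t - s)).
Hypothesis YV : forall omega t, s <= t -> (t%:E < tau omega)%E ->
  Y t omega = V omega (t - s).

Let measurable_path (g : R -> R) omega : measurable_fun (`[0, +oo[ : set R) g ->
  measurable_fun setT (fun u : R => g (V omega (u - s))).
Proof.
move=> mg; apply: (@measurable_comp _ _ _ _ _ _ (`[0, +oo[ : set R) g setT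
  (fun u : R => V omega (u - s))) => //.
  by move=> _ [u _ <-]/=; rewrite in_itv/=; case: (aV omega) => _ ->.
case: (aV omega) => cV _ _ _.
apply: (measurableT_comp (continuous_measurable_fun cV)).
by apply: measurable_funB => //; exact: measurable_cst.
Qed.

Let alive omega t u : s <= t -> (t%:E < tau omega)%E -> u \in `[s, t] ->
  Y u omega = V omega (u - s).
Proof.
move=> st ttau; rewrite inE/= in_itv/= => /andP[su ut]; apply: YV => //.
by apply: le_lt_trans ttau; rewrite lee_fin.
Qed.

(** A solution alive at [t] coincides with its absorbed path on all of [[s, t]], so on this event
    the integrand can be exchanged under the integral. *)
Lemma squared_distance_event t e (H : simple_process (Omega := Omega) (R := R)) :
  s <= t ->
  [set omega | (t%:E < tau omega)%E] `&` [set omega | (e%:E <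
    \int[mu]_(u in `[s, t]) ((simple_val H u omega - sigma (Y u omega)) ^+ 2)%R%:E)%E] =
  [set omega | 0 < V omega (t - s) /\
    (e%:E < squared_distance sigma (shift_process s H) V (t - s) omega)%E].
Proof.
move=> st; apply/seteqP.
suff sqE omega : (t%:E < tau omega)%E ->
  (\int[mu]_(u in `[s, t]) ((simple_val H u omega - sigma (Y u omega)) ^+ 2)%R%:E)%E
  = squared_distance sigma (shift_process s H) V (t - s) omega.
  split=> omega /= [talive]; first by rewrite sqE// -tauV.
  by rewrite -tauV// in talive; rewrite sqE.
move=> talive.
transitivity (\int[mu]_(u in `[s, t])
    ((simple_val H u omega - sigma (V omega (u - s))) ^+ 2)%R%:E)%E.
  by apply: eq_integral => u ust; rewrite (alive st talive).
rewrite ge0_integral_shift; last 2 first.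
- apply/measurable_EFinP/measurable_funX/measurable_funB; last exact: measurable_path.
  apply: measurable_sum => i; apply: measurable_funM; first exact: measurable_cst.
  by apply: measurable_indic; exact: measurable_itv.
- by move=> u; rewrite lee_fin sqr_ge0.
by apply: eq_integral => u _; rewrite simple_val_shift [s + u]addrC addrK.
Qed.

Lemma integral_error_event t e w (H : simple_process (Omega := Omega) (R := R)) :
  s <= t ->
  [set omega | (t%:E < tau omega)%E] `&` [set omega | (e%:E <
    `|simple_integral (wiener_from w s) H omega -
      (Y t omega - x - \int[mu]_(u in `[s, t]) b (Y u omega))|%:E)%E] =
  [set omega | 0 < V omega (t - s) /\
    (e%:E < (integral_error b (fun r omega => path_from w s omega r)
       (shift_process s H) V x (t - s) omega)%:E)%E].
Proof.
move=> st; apply/seteqP.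
suff eE omega : (t%:E < tau omega)%E ->
  `|simple_integral (wiener_from w s) H omega -
      (Y t omega - x - \int[mu]_(u in `[s, t]) b (Y u omega))| =
  integral_error b (fun r omega => path_from w s omega r)
       (shift_process s H) V x (t - s) omega.
  split=> omega /= [talive]; first by rewrite eE// -tauV.
  by rewrite -tauV// in talive; rewrite eE.
move=> talive; rewrite /integral_error YV//; congr (`|_ - (_ - _)|).
  apply: eq_bigr => i _; congr (_ * _).
  rewrite /wiener_from /path_from /=.
  by rewrite ![s + _]addrC !subrK; ring.
transitivity (\int[mu]_(u in `[s, t]) b (V omega (u - s))).
  by congr fine; apply: eq_integral => u ust; rewrite (alive st talive).
rewrite Rintegral_shift; last exact: measurable_path.
by congr fine; apply: eq_integral => u _; rewrite [s + u]addrC addrK.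
Qed.

End error_events.

Section transfer.
Context {d : measure_display} {Omega : measurableType d} {R : realType}.
Variable P : probability Omega R.
Local Notation mu := (@lebesgue_measure R).
Variable w : R -> Omega -> R.
Hypothesis w_wiener : is_wiener P w.
Local Notation paths := (path_space [set r : R | 0 <= r]).

Lemma measurable_path_event (s : R) (C : set paths) : measurable C ->
  measurable (path_from w s @^-1` C).
Proof.
move=> mC; rewrite -[X in measurable X]setTI.
exact: (measurable_path_from w_wiener s measurableT mC).
Qed.

Lemma path_event_transfer (s s' : R) (E : set Omega) (C : set paths) :
  measurable E -> measurable C ->
  {ae P, forall omega, E omega <-> C (path_from w s omega)} ->
  P E = P (path_from w s' @^-1` C).
Proof.
move=> mE mC EC; rewrite -(path_law w_wiener s s' mC).
by apply: eq_measure_ae EC => //; exact: measurable_path_event.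
Qed.

Lemma path_negligible_transfer (s s' : R) (C : set paths) : measurable C ->
  {ae P, forall omega, C (path_from w s omega)} ->
  {ae P, forall omega, C (path_from w s' omega)}.
Proof.
move=> mC aeC.
have : P (path_from w s' @^-1` C) = P setT.
  apply/esym/(path_event_transfer _ _ mC) => //.
  by apply: filterS aeC => omega Comega; split => // _; exact: Comega.
rewrite probability_setT => PC.
have mC' := measurable_path_event s' mC.
exists (~` (path_from w s' @^-1` C)); split => //; first exact: measurableC.
by rewrite probability_setC// PC subee.
Qed.

Definition transferred_process (s s' : R)
    (H : simple_process (Omega := Omega) (R := R))
    (Hh : simple_process (Omega := paths) (R := R)) :=
  SimpleProcess (sp_size H) (fun i => sp_knot H i - s + s')
    (fun i omega => sp_coef Hh i (path_from w s' omega)).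

Lemma is_simple_knot_ge F (s t : R) (H : simple_process (Omega := Omega) (R := R)) i :
  is_simple F s t H -> (i <= sp_size H)%N -> s <= sp_knot H i.
Proof.
move=> [H0 _ HF]; elim: i => [|i ih] iH; first by rewrite H0.
by have [+ _ _] := HF i iH; apply: le_trans; exact/ih/ltnW.
Qed.

(** Each coefficient is measurable at its own knot, so Doob-Dynkin represents it by a functional of
    the path up to that knot. Evaluated on the path from [s'], this functional is again adapted. *)
Lemma simple_process_transfer (s s' t : R)
    (H : simple_process (Omega := Omega) (R := R)) :
  is_simple (filtration_from P w s) s t H ->
  exists Hh : simple_process (Omega := paths) (R := R),
    [/\ sp_size Hh = sp_size H, forall i, sp_knot Hh i = sp_knot H i - s,
        forall i, (i < sp_size H)%N -> measurable_fun setT (sp_coef Hh i),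
        {ae P, forall omega, forall i, (i < sp_size H)%N ->
          sp_coef Hh i (path_from w s omega) = sp_coef H i omega}
      & is_simple (filtration_from P w s') s' (t - s + s')
          (transferred_process s s' H Hh)].
Proof.
move=> [H0 Ht HF].
have /choice[ch chP] (i : nat) : exists c : paths -> R, (i < sp_size H)%N ->
    [/\ measurable_fun setT c,
      exists K : R, forall p, `|c p| <= K,
      {ae P, forall omega, c (path_from w s omega) = sp_coef H i omega}
    & forall B : set R, measurable B -> filtration_from P w s' (sp_knot H i - s + s')
         ((fun omega => c (path_from w s' omega)) @^-1` B)].
  have [iH|_] := ltnP i (sp_size H); last by exists (cst 0).
  have [_ [K HK] /doob_dynkin_ae[Z [mZ aeZ]]] := HF i iH.
  have K0 : 0 <= K by exact: le_trans (HK point).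
  (* Doob-Dynkin controls the functional only almost surely, whereas [is_simple] asks for a bound
     everywhere; clipping at the bound [K] of the coefficient restores it. *)
  pose c p := Num.max (- K) (Num.min K (Z p)); exists c => _.
  have mc : measurable_fun setT
      (c : path_space [set r | 0 <= r <= sp_knot H i - s] -> R).
    apply: measurable_maxr; first exact: measurable_cst.
    by apply: measurable_minr => //; exact: measurable_cst.
  have mcp : measurable_fun setT (c : paths -> R).
    move=> _ B mB; rewrite setTI.
    apply: (@measurable_path_spaceS R [set r | 0 <= r <= sp_knot H i - s]).
      by move=> r /= /andP[].
    have := mc measurableT B mB; rewrite setTI; exact.
  split => //.
  - exists K => p; rewrite /c ler_norml le_max lexx/= ge_max ge_min lexx andbT.
    by rewrite (le_trans _ K0)// oppr_le0.
  - apply: filterS aeZ => omega Zomega; rewrite /c -Zomega.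
    have := HK omega; rewrite ler_norml => /andP[K1 K2].
    by rewrite min_r// max_r.
  - move=> B mB; apply/filtration_fromP; split.
      apply: (measurable_path_event s' (C := c @^-1` B)).
      by have := mcp measurableT B mB; rewrite setTI; exact.
    rewrite addrK; exists (c @^-1` B).
      by have := mc measurableT B mB; rewrite setTI; exact.
    rewrite (_ : _ `+` _ = set0); first exact: negligible_set0.
    exact: setYK.
exists (SimpleProcess (sp_size H) (fun i => sp_knot H i - s) ch); split => //=.
- by move=> i /chP[].
- apply: ae_foralln => i; have [iH|_] := ltnP i (sp_size H).
    by have [_ _ aei _] := chP i iH; apply: filterS aei.
  exact/aeW.
- split => /=.
  + by rewrite H0 subrr add0r.
  + by rewrite Ht.
  + move=> i iH; have [_ [K HK] _ Fi] := chP i iH.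
    split => //; first by have [? _ _] := HF i iH; lra.
    by exists K => omega.
Qed.

End transfer.

Section strong_solution_transfer.
Context {d : measure_display} {Omega : measurableType d} {R : realType}.
Variable P : probability Omega R.
Local Notation mu := (@lebesgue_measure R).
Variable w : R -> Omega -> R.
Hypothesis w_wiener : is_wiener P w.
Variables sigma b : R -> R.
Hypothesis sigma_borel : measurable_fun (`[0, +oo[ : set R) sigma.
Hypothesis b_borel : measurable_fun (`[0, +oo[ : set R) b.
Local Notation paths := (path_space [set r : R | 0 <= r]).

Lemma filtration_fromC (s t : R) (A : set Omega) :
  filtration_from P w s t A -> filtration_from P w s t (~` A).
Proof.
move=> /filtration_fromP[mA [C mC nC]]; apply/filtration_fromP; split.
  exact: measurableC.
exists (~` C); first exact: measurableC.
rewrite (_ : _ `+` _ = A `+` path_from w s @^-1` C)//.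
by apply/seteqP; split => omega /= [] [h1 h2]; [right|left|right|left];
  split => //; exact: contrapT.
Qed.

(** Adaptedness of a solution is stated on the event of being alive. A set containing the value 0 of
    a dead path is treated through its complement. *)
Lemma filtration_absorbed (s t : R) (tau : Omega -> \bar R) (Y : R -> Omega -> R) :
  (forall B : set R, measurable B ->
    filtration_from P w s t [set omega | (t%:E < tau omega)%E /\ B (Y t omega)]) ->
  forall B : set R, measurable B -> filtration_from P w s t
    [set omega | B (if (t%:E < tau omega)%E then Y t omega else 0)].
Proof.
move=> FY B mB; have [B0|nB0] := pselect (B 0); last first.
  rewrite (_ : mkset _ = [set omega | (t%:E < tau omega)%E /\ B (Y t omega)]).
    exact: FY.
  by apply/seteqP; split => omega /=; case: ifPn => // ? [].
rewrite (_ : mkset _ = ~` [set omega | (t%:E < tau omega)%E /\ (~` B) (Y t omega)]).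
  by apply/filtration_fromC/FY/measurableC.
apply/seteqP; split => omega /=; case: ifPn => ta Bo.
- by move=> [_]; apply.
- by move=> [].
- by apply: contrapT => nB; apply: Bo.
- by [].
Qed.

Lemma measurable_pos_lt {d'} {T : measurableType d'} (v : T -> R) (F : T -> \bar R)
    (e : \bar R) : measurable_fun setT v -> measurable_fun setT F ->
  measurable [set z | 0 < v z /\ (e < F z)%E].
Proof.
move=> mv mF; rewrite (_ : mkset _ = v @^-1` `]0, +oo[ `&` [set z | (e < F z)%E]).
  apply: measurableI.
    by rewrite -[X in measurable X]setTI; apply: mv => //; exact: measurable_itv.
  by rewrite -[X in measurable X]setTI; exact: emeasurable_fun_o_infty.
by apply/seteqP; split => z /=; rewrite in_itv/= andbT.
Qed.

Section simple_processes.
Variables (s s' : R) (H : simple_process (Omega := Omega) (R := R)).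
Variable (Hh : simple_process (Omega := paths) (R := R)).
Hypothesis size_Hh : sp_size Hh = sp_size H.
Hypothesis knot_Hh : forall i, sp_knot Hh i = sp_knot H i - s.

Lemma simple_val_transferred u omega :
  simple_val (shift_process s' (transferred_process w s s' H Hh)) u omega =
  simple_val Hh u (path_from w s' omega).
Proof.
rewrite /simple_val/= -size_Hh; apply: eq_bigr => i _.
by rewrite !addrK !knot_Hh.
Qed.

Lemma simple_integral_transferred omega :
  simple_integral (fun r omega => path_from w s' omega r)
    (shift_process s' (transferred_process w s s' H Hh)) omega =
  simple_integral (fun r (p : paths) => p r) Hh (path_from w s' omega).
Proof.
rewrite /simple_integral/= -size_Hh; apply: eq_bigr => i _.
by rewrite !addrK !knot_Hh.
Qed.

Variable omega : Omega.
Hypothesis coef_Hh : forall i, (i < sp_size H)%N ->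
  sp_coef Hh i (path_from w s omega) = sp_coef H i omega.

Lemma simple_val_path u :
  simple_val (shift_process s H) u omega = simple_val Hh u (path_from w s omega).
Proof.
rewrite /simple_val size_Hh; apply: eq_bigr => i _.
by rewrite coef_Hh//= !knot_Hh.
Qed.

Lemma simple_integral_path :
  simple_integral (fun r omega => path_from w s omega r) (shift_process s H) omega =
  simple_integral (fun r (p : paths) => p r) Hh (path_from w s omega).
Proof.
rewrite /simple_integral size_Hh; apply: eq_bigr => i _.
by rewrite coef_Hh//= !knot_Hh.
Qed.

End simple_processes.

Lemma eq_vanishes (A A' : set Omega) (Z Z' : nat -> Omega -> \bar R) :
  (forall (e : R) k, P (A' `&` [set omega | (e%:E < Z' k omega)%E]) =
    P (A `&` [set omega | (e%:E < Z k omega)%E])) ->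
  vanishes_in_probability_on P A Z -> vanishes_in_probability_on P A' Z'.
Proof.
move=> ZZ' vZ e e0; rewrite [X in X @ \oo](_ : _ =
  fun k => P (A `&` [set omega | (e%:E < Z k omega)%E])); first exact: vZ.
exact/funext.
Qed.

(* Both solutions are compared with their image on path space.  Since [Omega] is not
   assumed complete, the events in the definition of the Ito integral have to be
   measurable, and not only almost equal to path events. *)
Lemma strong_solution_transfer (s s' x : R) (tau : Omega -> \bar R)
    (Y : R -> Omega -> R) : 0 < x -> is_strong_solution P sigma b w s x tau Y ->
  exists tau' Y', is_strong_solution P sigma b w s' x tau' Y' /\
    forall (L : R) (B : set R), 0 <= L -> measurable B ->
      P [set omega | ((s + L)%:E < tau omega)%E /\ B (Y (s + L) omega)] =
      P [set omega | ((s' + L)%:E < tau' omega)%E /\ B (Y' (s' + L) omega)].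
Proof.
move=> x0 [FY Ypath Yito].
pose V omega (u : R) := if ((s + Num.max 0 u)%:E < tau omega)%E
  then Y (s + Num.max 0 u) omega else 0.
have aV omega : absorbed_path x (V omega).
  have [? ? ? ? ?] := Ypath omega.
  exact: (solution_absorbed_path (Y := Y ^~ omega)).
have cV omega : continuous (V omega) by case: (aV omega).
have V0 omega u : 0 <= V omega u by case: (aV omega).
have tauV omega t : s <= t -> (t%:E < tau omega)%E = (0 < V omega (t - s)).
  move=> st; rewrite /V max_r ?subr_ge0// addrC subrK.
  case: ifPn => [talive|]; last by rewrite ltxx.
  by have [_ _ Y0 _ _] := Ypath omega; rewrite Y0.
have YV omega t : s <= t -> (t%:E < tau omega)%E -> Y t omega = V omega (t - s).
  by move=> st talive; rewrite /V max_r ?subr_ge0// addrC subrK talive.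
have FV u (B : set R) : 0 <= u -> measurable B ->
    filtration_from P w s (s + u) (V ^~ u @^-1` B).
  move=> u0 mB; rewrite /preimage /V max_r//.
  apply: (@filtration_absorbed s (s + u) tau Y) => // B' mB'.
  by apply: FY => //; rewrite lerDl.
have mV u : measurable_fun setT (V ^~ u).
  have [u0|/ltW u0] := leP 0 u; last first.
    rewrite (_ : V ^~ u = cst x); first exact: measurable_cst.
    by apply/funext => omega; case: (aV omega) => _ _ ->.
  by move=> _ B mB; rewrite setTI; have [] := FV u B u0 mB.
have [Vb [aVb mVb VbV]] := canonical_path x0 aV FV.
have cVb p : continuous (Vb p) by case: (aVb p).
have Vb0 p u : 0 <= Vb p u by case: (aVb p).
pose V' omega := Vb (path_from w s' omega).
have aV' omega : absorbed_path x (V' omega) by exact: aVb.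
pose tau' omega := lifetime s' (V' omega).
pose Y' t omega := V' omega (t - s').
have tauV' omega t : s' <= t -> (t%:E < tau' omega)%E = (0 < V' omega (t - s')).
  exact: lt_lifetime.
have YV' omega t : s' <= t -> (t%:E < tau' omega)%E -> Y' t omega = V' omega (t - s').
  by [].
have mevent u (B : set R) : measurable B ->
    measurable [set p : paths | 0 < Vb p u /\ B (Vb p u)].
  move=> mB; rewrite (_ : mkset _ = Vb ^~ u @^-1` (`]0, +oo[ `&` B)).
    rewrite -[X in measurable X]setTI; apply: mVb => //.
    by apply: measurableI => //; exact: measurable_itv.
  by apply/seteqP; split => p /=; rewrite in_itv/= andbT.
exists tau', Y'; split; last first.
  move=> L B L0 mB; pose C := [set p : paths | 0 < Vb p L /\ B (Vb p L)].
  rewrite (_ : [set omega | ((s + L)%:E < tau omega)%E /\ B (Y (s + L) omega)] =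
      V ^~ L @^-1` (`]0, +oo[ `&` B)); last first.
    have sL : s + L - s = L by rewrite addrC addKr.
    have ssL : s <= s + L by rewrite lerDl.
    have tL omega : (0 < V omega L) = ((s + L)%:E < tau omega)%E by rewrite tauV// sL.
    apply/seteqP; split => omega /=; rewrite in_itv/= andbT tL.
      by move=> [alive]; rewrite YV// sL.
    by move=> [alive]; rewrite YV// sL.
  rewrite (path_event_transfer w_wiener (s := s) s' _ (mevent L B mB)); last 2 first.
  - rewrite -[X in measurable X]setTI; apply: mV => //.
    by apply: measurableI => //; exact: measurable_itv.
  - by apply: filterS VbV => omega Vbo; rewrite /= in_itv/= andbT Vbo.
  congr (P _); apply/seteqP; split => omega /=;
    by rewrite tauV' ?lerDl// /Y' /V' [_ + L]addrC addrK.
have Ldef (t : R) : s' <= t -> s <= s + (t - s') by rewrite lerDl subr_ge0.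
split.
- move=> t B st mB.
  rewrite (_ : mkset _ = path_from w s' @^-1`
      [set p : paths | 0 < Vb p (t - s') /\ B (Vb p (t - s'))]); last first.
    by apply/seteqP; split => omega /=; rewrite tauV'.
  apply/filtration_fromP; split.
    by apply: (measurable_path_event w_wiener s'); exact: mevent.
  have tL : 0 <= t - s' by rewrite subr_ge0.
  have mB0 : measurable (`]0, +oo[ `&` B).
    by apply: measurableI => //; exact: measurable_itv.
  have /filtration_fromP[_ [C mC nC]] := FV _ _ tL mB0.
  have {}mC : (measurable : set (set (path_space [set r | 0 <= r <= t - s']))) C.
    by move: mC; rewrite [s + _]addrC addrK.
  exists C => //.
  have mC' : (measurable : set (set paths)) C.
    by apply: measurable_path_spaceS mC => r /= /andP[].
  (* [C0] depends a priori on the whole path, [C] only on the path up to [t - s']. They agree almost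
     surely along the path from [s], and this agreement is itself a path event, so it holds almost
     surely along the path from [s']. *)
  pose C0 := [set p : paths | 0 < Vb p (t - s') /\ B (Vb p (t - s'))].
  have mC0 : measurable C0 by exact: mevent.
  have : {ae P, forall omega, ((C0 `&` C) `|` (~` C0 `&` ~` C)) (path_from w s' omega)}.
    apply: (path_negligible_transfer w_wiener (s := s) s'
      (C := (C0 `&` C) `|` (~` C0 `&` ~` C))).
      apply: measurableU; apply: measurableI => //; exact: measurableC.
    have aeC : {ae P, forall omega, (V omega (t - s') > 0 /\ B (V omega (t - s')))
        <-> C (path_from w s omega)}.
      have [N [mN PN0 NS]] := nC; exists N; split => //.
      apply: subset_trans NS => omega /= nVC.
      have [Vo|nVo] := pselect (V omega (t - s') > 0 /\ B (V omega (t - s'))).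
        left; split; first by rewrite in_itv/= andbT.
        by move=> Co; apply: nVC.
      right; split; last by rewrite in_itv/= andbT.
      by apply: contrapT => nCo; apply: nVC.
    apply: filterS2 VbV aeC => omega Vbo Co.
    have [c|nc] := pselect (C (path_from w s omega)); [left|right].
      by split => //; rewrite /C0/= Vbo; exact/Co.
    by split => //; rewrite /C0/= Vbo => /Co.
  move=> [N [mN PN0 NS]]; exists N; split => //.
  apply: subset_trans NS => omega /= h1 h2.
  by case: h1; case: h2 => -[? ?] [].
- by move=> omega; exact: lifetime_pathwise.
(* The approximating sequence is taken at the time with the same elapsed duration, [s + (t - s')].
   Both error events are then preimages, exactly at [s'] and almost surely at [s], of one path
   event. *)
- move=> t st; have [Hn [simpleH sqH intH]] := Yito _ (Ldef t st).
  have [Hh HhP] := choice (fun k => simple_process_transfer w_wiener s' (simpleH k)).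
  pose L := t - s'.
  have sL : s + (t - s') - s = L by rewrite addrC addKr.
  have mcoef k i : (i < sp_size (Hn k))%N -> measurable_fun setT (sp_coef (Hn k) i).
    have [_ _ HF] := simpleH k; move=> /HF[_ _ Fi] _ B mB.
    by rewrite setTI; have [] := Fi B mB.
  have mcoefh k i : (i < sp_size (Hh k))%N -> measurable_fun setT (sp_coef (Hh k) i).
    by have [-> _ + _ _] := HhP k; apply.
  exists (fun k => transferred_process w s s' (Hn k) (Hh k)); split.
  + move=> k; have [_ _ _ _] := HhP k.
    by rewrite sL subrK.
  + apply: eq_vanishes sqH => e k.
    rewrite (squared_distance_event sigma_borel aV tauV YV)//; last exact: Ldef.
    rewrite (squared_distance_event sigma_borel aV' tauV' YV')// sL -/L.
    have [sz kn _ aeco _] := HhP k.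
    rewrite [RHS](path_event_transfer w_wiener (s := s) s'
      (C := [set p : paths | 0 < Vb p L /\
      (e%:E < squared_distance sigma (Hh k) Vb L p)%E])).
    * have sqE omega : squared_distance sigma
          (shift_process s' (transferred_process w s s' (Hn k) (Hh k))) V' L omega =
          squared_distance sigma (Hh k) Vb L (path_from w s' omega).
        by apply: eq_integral => u _; rewrite (simple_val_transferred _ sz kn).
      by congr (P _); apply/seteqP; split => omega; rewrite /preimage /mkset sqE.
    * apply: measurable_pos_lt => //; apply/measurable_squared_distance => //.
      exact: mcoef.
    * apply: measurable_pos_lt => //; apply/measurable_squared_distance => //.
      exact: mcoefh.
    * apply: filterS2 VbV aeco => omega Vbo co /=.
      rewrite Vbo; have -> // :
          squared_distance sigma (shift_process s (Hn k)) V L omega =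
          squared_distance sigma (Hh k) Vb L (path_from w s omega).
      by apply: eq_integral => u _; rewrite (simple_val_path sz kn co) Vbo.
  + apply: eq_vanishes intH => e k.
    rewrite (integral_error_event b_borel aV tauV YV)//; last exact: Ldef.
    rewrite (integral_error_event b_borel aV' tauV' YV')// sL -/L.
    have [sz kn _ aeco _] := HhP k.
    rewrite [RHS](path_event_transfer w_wiener (s := s) s'
      (C := [set p : paths | 0 < Vb p L /\
      (e%:E < (integral_error b (fun r (p : paths) => p r) (Hh k) Vb x L p)%:E)%E])).
    * congr (P _); apply/seteqP; split => omega;
        by rewrite /preimage /mkset /integral_error /V'
          (simple_integral_transferred _ sz kn).
    * apply: measurable_pos_lt => //; apply/measurable_EFinP.
      apply: measurable_integral_error => //; first exact: mcoef.
      move=> i iH; case: w_wiener => mw _ _ _.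
      exact: measurable_funB (mw _) (mw _).
    * apply: measurable_pos_lt => //; apply/measurable_EFinP.
      apply: measurable_integral_error => //; first exact: mcoefh.
      move=> i; rewrite sz => iH.
      apply: (eq_measurable_fun (fun p : paths =>
        (p (sp_knot (Hh k) i.+1) - p 0) - (p (sp_knot (Hh k) i) - p 0))).
        by move=> p _; ring.
      apply: measurable_funB; apply: measurable_coord; rewrite /= kn subr_ge0;
        apply: (is_simple_knot_ge (simpleH k)) => //; exact: ltnW.
    * apply: filterS2 VbV aeco => omega Vbo co /=.
      by rewrite /integral_error (funext Vbo) (simple_integral_path sz kn co).
Qed.

End strong_solution_transfer.

(** * Invariance of the flow and of the scheme under a change of starting time *)

Section stationarity.
Context {d : measure_display} {Omega : measurableType d} {R : realType}.
Variable P : probability Omega R.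
Variable w : R -> Omega -> R.
Hypothesis w_wiener : is_wiener P w.
Variables sigma b : R -> R.
Hypothesis sigma_borel : measurable_fun (`[0, +oo[ : set R) sigma.
Hypothesis b_borel : measurable_fun (`[0, +oo[ : set R) b.
Local Notation paths := (path_space [set r : R | 0 <= r]).

Lemma measurable_gt_preimage {d'} {T : measurableType d'} (F : T -> R) (x : R) :
  measurable_fun setT F -> measurable [set z | x < F z].
Proof.
move=> mF; rewrite (_ : mkset _ = F @^-1` `]x, +oo[).
  by rewrite -[X in measurable X]setTI; apply: mF => //; exact: measurable_itv.
by apply/seteqP; split => z /=; rewrite in_itv/= andbT.
Qed.

(** As [x >= 0], an absorbed path does not exceed [x], so the event concerns living solutions only.
    Uniqueness is used at [s'], to identify the transferred solution with the one behind the
    flow. *)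
Lemma absorbing_flow_stationary (X : R -> R -> R -> Omega -> R) (s s' L x y : R) :
  is_absorbing_flow P sigma b w X -> 0 <= L -> 0 <= x -> 0 < y ->
  P [set omega | x < X s (s + L) y omega] = P [set omega | x < X s' (s' + L) y omega].
Proof.
move=> [mX _ solX] L0 x0 y0.
have sL (t : R) : t <= t + L by rewrite lerDl.
have absorbedE t tau Y : is_strong_solution P sigma b w t y tau Y ->
    {ae P, forall omega, forall r, t <= r -> X t r y omega = absorbed tau Y r omega} ->
    P [set omega | x < X t (t + L) y omega] =
    P [set omega | ((t + L)%:E < tau omega)%E /\ `]x, +oo[ (Y (t + L) omega)].
  move=> [FY _ _] aeX; apply: eq_measure_ae.
  - exact/measurable_gt_preimage/mX/ltW.
  - by have [] := FY (t + L) `]x, +oo[ (sL t) (measurable_itv _).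
  - apply: filterS aeX => omega /(_ _ (sL t)) /= ->; rewrite /absorbed in_itv/= andbT.
    case: ifPn => _; last by rewrite ltNge x0; split => // -[].
    by split=> [|[]].
have [tau [Y [[solY _] aeX]]] := solX s y y0.
have [tau1 [Y1 [[solY1 uniqY1] aeX1]]] := solX s' y y0.
have [tau' [Y' [solY' YY']]] :=
  strong_solution_transfer w_wiener sigma_borel b_borel s' y0 solY.
rewrite (absorbedE _ _ _ solY aeX) (absorbedE _ _ _ solY1 aeX1).
rewrite (YY' L `]x, +oo[ L0 (measurable_itv _)).
case: solY' (uniqY1 _ _ solY') => FY' _ _ aeY'; case: solY1 => FY1 _ _.
apply: eq_measure_ae.
- by have [] := FY' (s' + L) `]x, +oo[ (sL s') (measurable_itv _).
- by have [] := FY1 (s' + L) `]x, +oo[ (sL s') (measurable_itv _).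
- apply: filterS aeY' => omega [tt' YY1] /=; rewrite tt'.
  by split => -[alive]; rewrite YY1.
Qed.

Section euler.
Variable h : R.
Hypothesis h0 : 0 <= h.

Fixpoint euler_path (y : R) (m : nat) (p : R -> R) : R :=
  if m is m'.+1 then
    let z := euler_path y m' p in
    \1_(`]0, +oo[) z *
      Num.max 0 (z + sigma z * (p (m'.+1%:R * h) - p (m'%:R * h)) + b z * h)
  else y.

Lemma measurable_euler_path (y : R) (m : nat) :
  measurable_fun setT (euler_path y m : paths -> R).
Proof.
have mpos (g : R -> R) : measurable_fun (`[0, +oo[ : set R) g ->
    measurable_fun setT (fun z : R => \1_(`]0, +oo[) z * g z : R).
  move=> mg; rewrite (_ : (fun z => _) = g \_ `]0, +oo[).
    apply/(measurable_restrictT _ (measurable_itv _)).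
    apply: measurable_funS mg => //.
    by move=> z /=; rewrite !in_itv/= !andbT; exact: ltW.
  by apply/funext => z; rewrite patch_indic mulrC.
elim: m => [|m ih] /=; first exact: measurable_cst.
(* The coefficients are Borel on [[0, +oo[] only. The leading indicator of the scheme permits
   cutting them off at nonpositive states, and the increment is rewritten with recentred
   coordinates, which are measurable. *)
pose s0 (z : R) : R := \1_(`]0, +oo[ : set R) z * sigma z.
pose b0 (z : R) : R := \1_(`]0, +oo[ : set R) z * b z.
have m1 : measurable_fun setT (\1_(`]0, +oo[) : R -> R).
  by apply: measurable_indic; exact: measurable_itv.
apply: (eq_measurable_fun (fun p : paths => \1_(`]0, +oo[) (euler_path y m p) *
  Num.max 0 (euler_path y m p + s0 (euler_path y m p) *
    ((p (m.+1%:R * h) - p 0) - (p (m%:R * h) - p 0)) + b0 (euler_path y m p) * h))).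
  move=> p _; rewrite /s0 /b0 indicE; case: (_ \in _); last by rewrite !mul0r.
  by rewrite !mul1r (_ : _ - _ - _ = p (m.+1%:R * h) - p (m%:R * h))//; ring.
apply: measurable_funM; first exact: (measurableT_comp m1 ih).
apply: measurable_maxr; first exact: measurable_cst.
apply: measurable_funD.
  apply: measurable_funD; first exact: ih.
  apply: measurable_funM; first exact: (measurableT_comp (mpos _ sigma_borel) ih).
  by apply: measurable_funB; apply: measurable_coord; rewrite /= mulr_ge0.
by apply: measurable_funM => //; exact: (measurableT_comp (mpos _ b_borel) ih).
Qed.

Lemma euler_maruyama_path (Xn : int -> int -> R -> Omega -> R) (k : int)
    (m : nat) (y : R) omega :
  is_euler_maruyama P sigma b w h Xn -> 0 < y ->
  Xn k (k + m%:Z) y omega = euler_path y m (path_from w (grid h k) omega).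
Proof.
move=> [Xn0 XnS _ _] y0; elim: m => [|m ih]; first by rewrite addr0 Xn0.
have km : k + m.+1%:Z - 1 = k + m%:Z by rewrite -addn1 PoszD; ring.
rewrite XnS//; last by rewrite ltrDl.
rewrite /= km ih; set z := euler_path y m _.
rewrite /path_from /grid -!mulrDl.
by rewrite !intrD.
Qed.

Lemma measurable_euler_maruyama (Xn : int -> int -> R -> Omega -> R) (k : int)
    (m : nat) (y : R) :
  is_euler_maruyama P sigma b w h Xn -> 0 < y ->
  measurable_fun setT (Xn k (k + m%:Z) y).
Proof.
move=> Xn_EM y0; rewrite (_ : Xn _ _ _ =
    (euler_path y m : paths -> R) \o path_from w (grid h k)).
  move=> _ B mB; rewrite setTI.
  apply: (measurable_path_event w_wiener (grid h k) (C := euler_path y m @^-1` B)).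
  by have := measurable_euler_path y m measurableT mB; rewrite setTI; exact.
by apply/funext => omega; rewrite (euler_maruyama_path k m omega Xn_EM y0).
Qed.

Lemma euler_maruyama_stationary (Xn : int -> int -> R -> Omega -> R) (k k' : int)
    (m : nat) (x y : R) :
  is_euler_maruyama P sigma b w h Xn -> 0 < y ->
  P [set omega | x < Xn k (k + m%:Z) y omega] =
  P [set omega | x < Xn k' (k' + m%:Z) y omega].
Proof.
move=> Xn_EM y0; pose C := [set p : paths | x < euler_path y m p].
have mC : measurable C := measurable_gt_preimage x (@measurable_euler_path y m).
have E l : [set omega | x < Xn l (l + m%:Z) y omega] = path_from w (grid h l) @^-1` C.
  by apply/seteqP; split => omega /=; rewrite (euler_maruyama_path l m omega Xn_EM y0).
by rewrite !E; exact: path_law.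
Qed.

End euler.

End stationarity.

(** * Functions with an integrable right derivative *)

Section right_derivative.
Context {R : realType}.
Local Notation mu := (@lebesgue_measure R).
Implicit Types (F U phi : R -> R) (a b : R).

(** Continuous induction: let [c] be the supremum of the times at which the inequality holds. Left
    continuity of [F] and monotonicity of [U] give it at [c], and the local growth carries it beyond
    [c] unless [c = b]. In the application [U] is the primitive of a majorant. *)
Lemma right_growth_le F U a b (eta : R) : a <= b -> 0 <= eta ->
  (forall c, a < c -> c <= b -> F t @[t --> c^'-] --> F c) ->
  (forall y z, a <= y -> y <= z -> z <= b -> U y <= U z) ->
  (forall y, a <= y -> y < b -> exists2 delta, 0 < delta & forall h, 0 < h ->
     h < delta -> y + h <= b -> F (y + h) - F y <= U (y + h) - U y + eta * h) ->
  F b - F a <= U b - U a + eta * (b - a).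
Proof.
move=> ab eta0 cF ndU growth.
pose G t := F t - F a - eta * (t - a).
pose E := [set t | a <= t <= b /\ G t <= U t - U a].
have Ea : E a by split; rewrite ?lexx// /G !subrr mulr0 subr0.
have ubE : ubound E b by move=> t [/andP[]].
have supE : has_sup E by split; [exists a|exists b].
pose c := sup E.
have ac : a <= c by apply: ub_le_sup => //; exists b.
have cb : c <= b by apply: ge_sup => //; exists a.
have Ec : E c.
  split; first by rewrite ac cb.
  have [<-|/eqP ca] := eqVneq a c; first by case: Ea.
  have {ca}ac' : a < c by rewrite lt_neqAle ac andbT; exact/eqP.
  rewrite leNgt; apply/negP => Uc.
  pose e := G c - (U c - U a).
  have e0 : 0 < e by rewrite subr_gt0.
  have /cvgrPdist_lt /(_ _ e0) := cF c ac' cb.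
  rewrite near_withinE => /nbhs_ballP[delta /= delta0 deltaP].
  have [t Et ct] := sup_adherent delta0 supE.
  have tc : t <= c by apply: ub_le_sup => //; exists b.
  move: Et => [/andP[at_ tb] Gt].
  have [tc'|] := ltP t c; last first.
    move=> ct'; have tcE : t = c by apply/eqP; rewrite eq_le tc.
    by move: Gt; rewrite tcE leNgt Uc.
  have := deltaP t; rewrite /ball/= => /(_ _ tc').
  rewrite gtr0_norm ?subr_gt0//; move=> /(_ _).
  have -> : c - t < delta by move: ct; rewrite -/c; lra.
  move=> /(_ isT); rewrite ltr_norml => /andP[_ Fct].
  have Utc : U t <= U c by apply: ndU => //; lra.
  have : eta * (t - a) <= eta * (c - a) by apply: ler_wpM2l => //; lra.
  by move: Fct Gt Utc; rewrite /e /G; lra.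
have [cb'|] := ltP c b; last first.
  move=> bc; have cE : c = b by apply/eqP; rewrite eq_le cb.
  by case: Ec => _; rewrite cE /G; lra.
have [delta delta0 deltaP] := growth c ac cb'.
pose h := Num.min (delta / 2) (b - c).
have h0 : 0 < h by rewrite lt_min divr_gt0// subr_gt0.
have hd : h < delta by rewrite gt_min; apply/orP; left; lra.
have hb : c + h <= b by rewrite -lerBrDl ge_min lexx orbT.
have Ech : E (c + h).
  split; first by rewrite hb andbT; lra.
  have := deltaP h h0 hd hb; case: Ec => _.
  rewrite /G (_ : c + h - a = (c - a) + h); last by ring.
  by rewrite mulrDr; lra.
have : c + h <= c by apply: ub_le_sup => //; exists b.
by lra.
Qed.

(* With [E k] the set of [t] such that [k e <= phi t < (k + 1) e] and [V k] an open
   neighbourhood of [E k] that is slightly larger, take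
   [g = phi + e + \sum_k (k + 1) e \1_(V k \ E k)]. *)
Lemma vitali_caratheodory_upper phi a b (e : R) : a <= b -> 0 < e ->
  measurable_fun `[a, b] phi -> (forall t, a <= t <= b -> 0 <= phi t) ->
  exists g : R -> \bar R, [/\ measurable_fun `[a, b] g,
    forall t, a <= t <= b -> (0 <= g t)%E,
    (\int[mu]_(t in `[a, b]) g t <=
      \int[mu]_(t in `[a, b]) (phi t)%:E + (e * (b - a + 1))%:E)%E
    & forall y, a <= y <= b -> exists2 delta, 0 < delta &
        forall t, a <= t <= b -> `|y - t| < delta -> ((phi y)%:E <= g t)%E].
Proof.
move=> ab e0 mphi phi0; pose D : set R := `[a, b].
have mD : measurable D by exact: measurable_itv.
have inD t : D t = (a <= t <= b) by rewrite /D/= in_itv.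
pose E k := D `&` phi @^-1` `[k%:R * e, k.+1%:R * e[.
have mE k : measurable (E k) by apply: mphi => //; exact: measurable_itv.
(* With this tolerance the [k]-th correction costs at most [e / 2 ^ k.+1], so all of them cost at
   most [e]; the uniform shift by [e] costs [e * (b - a)]. Together they make the error term of the
   statement. *)
pose r k : R := 1 / (2 ^ k.+1)%:R / k.+1%:R.
have r0 k : 0 < r k.
  by rewrite !divr_gt0// ltr0n expn_gt0.
have /choice[V VP] k : exists V,
    [/\ open V, E k `<=` V & (mu (V `\` E k) < (r k)%:E)%E].
  apply: lebesgue_regularity_outer => //.
  apply: (@le_lt_trans _ _ (mu D)).
    apply: le_measure; [by apply/mem_set; exact: mE|exact/mem_set|].
    by move=> t [].
  by rewrite /= lebesgue_measure_itv/=; case: ifP => // _; rewrite -EFinB ltry.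
have mV k : measurable (V k `\` E k).
  by apply: measurableD => //; apply: open_measurable; case: (VP k).
pose f k t : \bar R := (k.+1%:R * e * \1_(V k `\` E k) t)%:E.
have f0 k t : (0 <= f k t)%E by rewrite lee_fin !mulr_ge0// ltW.
have mf k : measurable_fun D (f k).
  apply/measurable_EFinP/measurable_funM; first exact: measurable_cst.
  exact: measurable_indic.
pose g0 t : \bar R := (\sum_(k <oo) f k t)%E.
pose g t : \bar R := ((phi t + e)%:E + g0 t)%E.
have g00 t : (0 <= g0 t)%E by apply: nneseries_ge0 => k _ _; exact: f0.
have mg0 : measurable_fun D g0.
  exact: ge0_emeasurable_sum.
have mphie : measurable_fun D (fun t => (phi t + e)%:E).
  by apply/measurable_EFinP/measurable_funD => //; exact: measurable_cst.
have phie0 t : D t -> (0 <= (phi t + e)%:E)%E.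
  by rewrite inD => /phi0 ?; rewrite lee_fin addr_ge0// ltW.
exists g; split.
- exact: emeasurable_funD.
- by move=> t tab; rewrite adde_ge0// phie0// inD.
- rewrite ge0_integralD//.
  have -> : (\int[mu]_(t in D) (phi t + e)%:E =
      \int[mu]_(t in D) (phi t)%:E + (e * (b - a))%:E)%E.
    rewrite (_ : (fun t => (phi t + e)%:E) = (fun t => (phi t)%:E + cst e%:E t)%E)//.
    rewrite ge0_integralD//; last 2 first.
    + exact/measurable_EFinP.
    + by move=> t _; rewrite lee_fin ltW.
    congr (_ + _)%E; rewrite integral_cst//= lebesgue_measure_itv/= lte_fin.
    case: ltP => [_|ba]; first by rewrite -EFinB -EFinM.
    by rewrite mule0 (_ : b - a = 0) ?mulr0//; lra.
  rewrite (mulrDr e (b - a) 1) mulr1 EFinD [leRHS]addeA; apply: leeD2l.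
  rewrite integral_nneseries//.
  apply: le_trans (epsilon_trick0 xpredT (ltW e0)).
  apply: lee_nneseries => [k _ _|k _]; first by apply: integral_ge0.
  rewrite (_ : f k = fun t => ((k.+1%:R * e)%:E * (\1_(V k `\` E k) t)%:E)%E); last first.
    by apply/funext => t; rewrite -EFinM.
  rewrite ge0_integralZl_EFin//; last 2 first.
  + by apply/measurable_EFinP; apply: measurable_indic; exact: mV.
  + by rewrite mulr_ge0// ltW.
  rewrite integral_indic//; last exact: mV.
  apply: (@le_trans _ _ ((k.+1%:R * e)%:E * (r k)%:E)%E).
    apply: lee_wpmul2l; first by rewrite lee_fin mulr_ge0// ltW.
    apply: le_trans (ltW _); last by case: (VP k) => _ _; exact.
    apply: le_measure; [|by apply/mem_set; exact: mV|by move=> t []].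
    by apply/mem_set; apply: measurableI => //; exact: mV.
  rewrite -EFinM lee_fin.
  have -> // : k.+1%:R * e * r k = e / (2 ^ k.+1)%:R.
  by rewrite /r div1r mulrC mulrA mulfVK ?pnatr_eq0// mulrC.
- move=> y yab.
  pose k := Num.truncn (phi y / e).
  have := truncn_itv (divr_ge0 (phi0 _ yab) (ltW e0)).
  rewrite ler_pdivlMr// ltr_pdivrMr// -/k => /andP[k1 k2].
  have Eky : E k y by split; [rewrite inD|rewrite /= in_itv/= k1 k2].
  have [oV EV _] := VP k.
  have /nbhs_ballP[delta /= delta0 deltaP] : nbhs y (V k).
    by apply: open_nbhs_nbhs; split => //; exact: EV.
  exists delta => // t tab yt.
  have Vt : V k t by apply: deltaP.
  (* On [E k] the values of [phi] at [t] and [y] differ by less than [e], which the shift absorbs;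
     off [E k] the correction alone is [k.+1%:R * e], above [phi y]. *)
  have [Et|nEt] := pselect (E k t).
    apply: (@le_trans _ _ (phi t + e)%:E); last by rewrite leeDl.
    case: Et => _ /=; rewrite in_itv/= => /andP[kt _]; rewrite lee_fin.
    move: k2 kt; rewrite -natr1; lra.
  apply: (@le_trans _ _ (g0 t)); last by rewrite leeDr// phie0// inD.
  have : (\sum_(0 <= i < k.+1) f i t <= g0 t)%E by apply: nneseries_lim_ge.
  apply: le_trans; rewrite big_nat_recr//=.
  apply: (@le_trans _ _ (f k t)); last by rewrite leeDr// sume_ge0.
  rewrite /f indicE mem_set//.
  by rewrite mulr1 lee_fin ltW.
Qed.

(** A merely measurable [phi] says nothing about its integral just to the right of a given [y]. The
    majorant [g] stays above [phi y] near [y], so its primitive [U] grows there at least like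
    [phi y * h]. *)
Lemma ge0_right_derivative_le F phi a b : a <= b ->
  (forall c, a < c -> c <= b -> F t @[t --> c^'-] --> F c) ->
  measurable_fun `[a, b] phi -> (forall t, a <= t <= b -> 0 <= phi t) ->
  (forall y, a <= y -> y < b -> forall eta, 0 < eta ->
    exists2 delta, 0 < delta & forall h, 0 < h -> h < delta ->
      F (y + h) - F y <= phi y * h + eta * h) ->
  ((F b - F a)%:E <= \int[mu]_(t in `[a, b]) (phi t)%:E)%E.
Proof.
move=> ab cF mphi phi0 growth.
have phiD0 : (0 <= \int[mu]_(t in `[a, b]) (phi t)%:E)%E.
  by apply: integral_ge0 => t; rewrite /= in_itv/= lee_fin; exact: phi0.
apply/lee_addgt0Pr => e e0.
(* The two summands are the costs per unit of [e1]: of replacing [phi] by its majorant, and of the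
   slope error in the growth bound. *)
pose C := (b - a + 1) + (b - a).
have C0 : 0 < C by rewrite /C; lra.
pose e1 := e / C; have e10 : 0 < e1 by rewrite divr_gt0.
have [phifin|] := ltP (\int[mu]_(t in `[a, b]) (phi t)%:E)%E +oo%E; last first.
  by rewrite leye_eq => /eqP ->; rewrite leey.
have [g [mg g0 gphi gy]] := vitali_caratheodory_upper ab e10 mphi phi0.
have gD0 t : `[a, b]%classic t -> (0 <= g t)%E by rewrite /= in_itv/=; exact: g0.
have gfin : (\int[mu]_(t in `[a, b]) g t < +oo)%E.
  by apply: le_lt_trans gphi _; rewrite lte_add_pinfty// ltry.
have sub y z : a <= y -> z <= b -> `]y, z]%classic `<=` (`[a, b]%classic : set R).
  by move=> ay zb t /=; rewrite !in_itv/= => /andP[yt tz]; apply/andP; split; lra.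
have mgs y z : a <= y -> z <= b -> measurable_fun `]y, z] g.
  move=> ay zb; apply: measurable_funS mg => //; exact: sub.
pose I y z := (\int[mu]_(t in `]y, z]) g t)%E.
have Ile y z : a <= y -> z <= b -> (I y z <= \int[mu]_(t in `[a, b]) g t)%E.
  by move=> ay zb; apply: ge0_subset_integral => //; exact: sub.
have Ifin y z : a <= y -> z <= b -> I y z \is a fin_num.
  move=> ay zb; rewrite ge0_fin_numE; first exact: le_lt_trans (Ile _ _ ay zb) gfin.
  by apply: integral_ge0 => t /sub tab; apply: gD0; exact: tab.
pose U t := fine (I a t).
have Usplit y z : a <= y -> y <= z -> z <= b -> U z - U y = fine (I y z).
  move=> ay yz zb; have yb : y <= b by exact: le_trans zb.
  rewrite /U -fineB ?Ifin//; congr fine.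
  rewrite (_ : I a z = I a y + I y z)%E; first by rewrite addeAC subee ?Ifin// add0e.
  have azE : `]a, z]%classic = (`]a, y] `|` `]y, z])%classic :> set R.
    apply/seteqP; split => t /=; rewrite !in_itv/=.
      move=> /andP[at_ tz]; have [ty|yt] := leP t y; first by left; rewrite at_.
      by right.
    by move=> [] /andP[t1 t2]; apply/andP; split; lra.
  rewrite /I azE ge0_integral_setU//.
  - by rewrite -azE; exact: mgs.
  - move=> t; rewrite -azE => /sub tab; apply: gD0; exact: tab.
  - by apply/disj_setPS => t [] /=; rewrite !in_itv/= => /andP[_ ty] /andP[]; lra.
have U0 : U a = 0.
  by rewrite /U /I set_itvoc0 integral_set0.
have key : F b - F a <= U b - U a + e1 * (b - a).
  apply: right_growth_le => //; first exact: ltW.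
    move=> y z ay yz zb; rewrite -subr_ge0 Usplit//; apply: fine_ge0.
    by apply: integral_ge0 => t /sub tab; apply: gD0; exact: tab.
  move=> y ay yb; have yab : a <= y <= b by rewrite ay ltW.
  have [d1 d10 d1P] := growth y ay yb _ e10.
  have [d2 d20 d2P] := gy y yab.
  exists (Num.min d1 d2); first by rewrite lt_min d10.
  move=> h h0; rewrite lt_min => /andP[hd1 hd2] yhb.
  apply: le_trans (d1P h h0 hd1) _; rewrite lerD2r Usplit//; last by rewrite lerDl ltW.
  rewrite -lee_fin fineK ?Ifin//.
  have <- : (\int[mu]_(t in `]y, (y + h)%R]) (cst (phi y)%:E t) = (phi y * h)%:E)%E.
    rewrite integral_cst//= lebesgue_measure_itv/= lte_fin ltrDl h0.
    by rewrite -EFinB addrAC subrr add0r EFinM.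
  apply: ge0_le_integral => //.
  - by move=> t _; rewrite lee_fin phi0.
  - exact: mgs.
  - move=> t /=; rewrite in_itv/= => /andP[yt tyh]; apply: d2P.
      by apply/andP; split; lra.
    by rewrite ltr0_norm; lra.
rewrite U0 subr0 in key.
have Ub : ((U b)%:E <= \int[mu]_(t in `[a, b]) (phi t)%:E + (e1 * (b - a + 1))%:E)%E.
  by rewrite fineK ?Ifin//; apply: le_trans gphi; exact: Ile.
apply: (@le_trans _ _ ((U b)%:E + (e1 * (b - a))%:E)%E).
  by rewrite -EFinD lee_fin.
rewrite (_ : e = e1 * (b - a + 1) + e1 * (b - a)); last first.
  by rewrite -mulrDr -/C mulfVK// gt_eqF.
by rewrite EFinD addeA leeD2r.
Qed.

(* Truncating [phi] below at [- N] and adding [N t] to [F] reduces to [phi >= 0]. *)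
Lemma right_derivative_le F phi a b : a <= b ->
  (forall c, a < c -> c <= b -> F t @[t --> c^'-] --> F c) ->
  mu.-integrable `[a, b] (EFin \o phi) ->
  (forall y, a <= y -> y < b -> forall eta, 0 < eta ->
    exists2 delta, 0 < delta & forall h, 0 < h -> h < delta ->
      F (y + h) - F y <= phi y * h + eta * h) ->
  ((F b - F a)%:E <= \int[mu]_(t in `[a, b]) (phi t)%:E)%E.
Proof.
move=> ab cF iphi growth.
have mphi : measurable_fun `[a, b] phi.
  by apply/measurable_EFinP; case/integrableP : iphi.
pose phiN (N : nat) t := Num.max (phi t) (- N%:R).
have mphiN N : measurable_fun `[a, b] (phiN N).
  by apply: measurable_maxr => //; exact: measurable_cst.
have bound N t : `|phiN N t| <= `|phi t|.
  rewrite /phiN; have [pN|//] := leP (phi t) (- N%:R).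
  by rewrite normrN ger0_norm// ler_normr; apply/orP; right; lra.
have iphiN N : mu.-integrable `[a, b] (EFin \o phiN N).
  apply: le_integrable iphi => //; first by apply/measurable_EFinP; exact: mphiN.
  by move=> t _ /=; rewrite lee_fin bound.
have leN N : ((F b - F a)%:E <= \int[mu]_(t in `[a, b]) (phiN N t)%:E)%E.
  have := @ge0_right_derivative_le (fun t => F t + N%:R * t)
    (fun t => phiN N t + N%:R) a b ab.
  have ->: (\int[mu]_(t in `[a, b]) (phiN N t + N%:R)%:E =
      \int[mu]_(t in `[a, b]) (phiN N t)%:E + (N%:R * (b - a))%:E)%E.
    rewrite (_ : (fun t => (phiN N t + N%:R)%:E) =
      (fun t => (EFin \o phiN N) t + (EFin \o cst N%:R) t)%E)//.
    rewrite integralD//; last first.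
      apply/integrableP; split.
        by apply/measurable_EFinP; exact: measurable_cst.
      rewrite (_ : (fun _ => _) = cst `|N%:R : R|%:E)// integral_cst//=.
      rewrite lebesgue_measure_itv/=; case: ifP => _; last by rewrite mule0 ltry.
      by rewrite -EFinB -EFinM ltry.
    congr (_ + _)%E.
    transitivity (\int[mu]_(t in `[a, b]) cst (N%:R)%:E t)%E => //.
    rewrite integral_cst//= lebesgue_measure_itv/= lte_fin.
    case: ltP => [_|ba]; first by rewrite -EFinB -EFinM.
    by rewrite mule0 (_ : b - a = 0) ?mulr0//; lra.
  rewrite (_ : F b + _ - _ = (F b - F a) + N%:R * (b - a)); last by ring.
  rewrite EFinD leeD2rE// => H; apply: H.
  - move=> c ac cb; apply: cvgD; first exact: cF.
    apply: cvg_at_left_filter; apply: cvgM; [exact: cvg_cst|exact: cvg_id].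
  - by apply: measurable_funD => //; exact: measurable_cst.
  - by move=> t _; rewrite -lerBlDr sub0r le_max lexx orbT.
  - move=> y ay yb eta eta0; have [delta delta0 deltaP] := growth y ay yb eta eta0.
    exists delta => // h h0 hd; have := deltaP h h0 hd.
    have : phi y * h <= phiN N y * h.
      by apply: ler_wpM2r; [exact: ltW|rewrite /phiN le_max lexx].
    by rewrite !mulrDr !mulrDl; lra.
have cvgN : (\int[mu]_(t in `[a, b]) (phiN N t)%:E @[N --> \oo]
    --> \int[mu]_(t in `[a, b]) (phi t)%:E)%E.
  apply: (@dominated_cvg _ _ R mu `[a, b]%classic _ (fun N t => (phiN N t)%:E)
    (fun t => (phi t)%:E) (fun t => `|phi t|%:E)) => //.
  - by move=> N; apply/measurable_EFinP; exact: mphiN.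
  - move=> t _; apply/fine_cvgP; split; first exact: nearW.
    apply: cvg_near_cst; near=> N.
    rewrite /= /phiN max_l//.
    rewrite lerNl; apply: (@le_trans _ _ `|phi t|); first by rewrite -normrN ler_norm.
    near: N; exact: nbhs_infty_ger.
  - by have := integrable_abse iphi.
  - by move=> N t _; rewrite lee_fin bound.
by apply: (cvge_to_ge cvgN); exact: nearW.
Unshelve. all: by end_near. Qed.

Lemma integral_right_derivative F phi a b : a <= b ->
  (forall c, a < c -> c <= b -> F t @[t --> c^'-] --> F c) ->
  mu.-integrable `[a, b] (EFin \o phi) ->
  (forall y, a <= y -> y < b -> forall eta, 0 < eta ->
    exists2 delta, 0 < delta & forall h, 0 < h -> h < delta ->
      `|F (y + h) - F y - phi y * h| <= eta * h) ->
  (\int[mu]_(t in `[a, b]) (phi t)%:E)%E = (F b - F a)%:E.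
Proof.
move=> ab cF iphi growth; apply/eqP; rewrite eq_le; apply/andP; split; last first.
  apply: right_derivative_le => // y ay yb eta eta0.
  have [delta delta0 deltaP] := growth y ay yb eta eta0.
  exists delta => // h h0 hd; have := deltaP h h0 hd.
  by rewrite ler_norml => /andP[_]; lra.
rewrite -leeN2 -integralN/=; last exact: integrable_add_def.
have := @right_derivative_le (fun t => - F t) (fun t => - phi t) a b ab.
rewrite opprB (_ : - F b - - F a = F a - F b); last by ring.
apply.
- by move=> c ac cb; apply: cvgN; exact: cF.
- by have := integrableN iphi.
- move=> y ay yb eta eta0.
  have [delta delta0 deltaP] := growth y ay yb eta eta0.
  exists delta => // h h0 hd; have := deltaP h h0 hd.
  by rewrite mulNr ler_norml => /andP[]; lra.
Qed.

End right_derivative.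

(** * Expectations of the dual flows *)

Section nonmeasurable.
Context {d : measure_display} {T : measurableType d} {R : realType}.
Variable mu : {measure set T -> \bar R}.
Local Open Scope ereal_scope.

(* The dual flow is measurable only off a null set on which nothing is known. *)
Lemma ge0_le_integral_nonmeasurable (F G : T -> \bar R) :
  (forall x, 0 <= F x) -> (forall x, F x <= G x) ->
  \int[mu]_x F x <= \int[mu]_x G x.
Proof.
move=> F0 FG; have G0 x : 0 <= G x by exact: le_trans (FG x).
rewrite !ge0_integralTE//; apply: le_ereal_sup => _ [h hF <-]; exists h => // x.
exact: le_trans (FG x).
Qed.

(** [F] lies between [G] cut to 0 on the null set and [G] raised to [+oo] on it; both are measurable
    with the integral of [G]. *)
Lemma ge0_integral_ae_nonmeasurable (F G : T -> \bar R) :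
  (forall x, 0 <= F x) -> (forall x, 0 <= G x) -> measurable_fun setT G ->
  {ae mu, forall x, F x = G x} -> \int[mu]_x F x = \int[mu]_x G x.
Proof.
move=> F0 G0 mG [N [mN N0 NS]].
have FG x : ~ N x -> F x = G x by move=> nN; apply: contrapT => /NS.
have mN1 : measurable_fun setT (fun x => (\1_N x : R)%:E).
  by apply/measurable_EFinP; exact: measurable_indic.
have aeE (H : T -> \bar R) : (forall x, 0 <= H x) -> measurable_fun setT H ->
    (forall x, ~ N x -> H x = G x) -> \int[mu]_x H x = \int[mu]_x G x.
  move=> H0 mH HG; apply: ge0_ae_eq_integral => //.
  by exists N; split => // x /= nHG; apply: contrapT => /HG E; apply: nHG.
apply/eqP; rewrite eq_le; apply/andP; split.
  rewrite -(aeE (fun x => G x + +oo * (\1_N x)%:E)); last 3 first.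
  - by move=> x; rewrite adde_ge0// mule_ge0// lee_fin.
  - by apply: emeasurable_funD => //; apply: measurable_funeM.
  - by move=> x nN; rewrite indicE memNset// mule0 adde0.
  apply: ge0_le_integral_nonmeasurable => // x; have [xN|xN] := pselect (N x).
    rewrite indicE mem_set// mule1 addeC addye ?leey//.
    by rewrite gt_eqF// (lt_le_trans _ (G0 x)).
  by rewrite indicE memNset// mule0 adde0 FG.
rewrite -(aeE (fun x => G x * (\1_(~` N) x)%:E)); last 3 first.
- by move=> x; rewrite mule_ge0// lee_fin.
- apply: emeasurable_funM => //; apply/measurable_EFinP; apply: measurable_indic.
  exact: measurableC.
- by move=> x nN; rewrite indicE mem_set// mule1.
apply: ge0_le_integral_nonmeasurable => x; first by rewrite mule_ge0// lee_fin.
have [xN|xN] := pselect (N x); first by rewrite indicE memNset ?mule0//; exact.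
by rewrite indicE mem_set// mule1 FG.
Qed.

Lemma integral_ae_nonmeasurable (F G : T -> \bar R) : measurable_fun setT G ->
  {ae mu, forall x, F x = G x} -> \int[mu]_x F x = \int[mu]_x G x.
Proof.
move=> mG FG; rewrite integralE [RHS]integralE; congr (_ - _).
  apply: ge0_integral_ae_nonmeasurable => //; first exact: measurable_funepos.
  by apply: filterS FG => x E; rewrite !funeposE E.
apply: ge0_integral_ae_nonmeasurable => //; first exact: measurable_funeneg.
by apply: filterS FG => x E; rewrite !funenegE E.
Qed.

End nonmeasurable.

Section clipped_expectation.
Context {d : measure_display} {Omega : measurableType d} {R : realType}.
Variable P : probability Omega R.
Variable f : R -> R.
Hypothesis cf : continuous f.
Variable K : R.
Hypothesis fK : forall y, `|f y| <= K.

Definition clipped_expectation (Y : Omega -> R) (y : R) : R :=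
  \int[P]_omega f (Num.min (Y omega) y).

Variable Y : Omega -> R.
Hypothesis mY : measurable_fun setT Y.
Hypothesis Y0 : forall omega, 0 <= Y omega.

Let bounded_integrable (g : Omega -> R) (K' : R) : measurable_fun setT g ->
  (forall omega, `|g omega| <= K') -> P.-integrable setT (EFin \o g).
Proof.
move=> mg gK; apply: measurable_bounded_integrable => //.
  by rewrite -ge0_fin_numE//; exact: fin_num_measure.
exists K'; split; first exact: num_real.
by move=> M KM omega _ /=; rewrite (le_trans (gK _))// ltW.
Qed.

Let measurable_clip y : measurable_fun setT (fun omega => f (Num.min (Y omega) y)).
Proof.
apply: (measurableT_comp (continuous_measurable_fun cf)).
by apply: measurable_minr => //; exact: measurable_cst.
Qed.

Let integrable_clip y :
  P.-integrable setT (EFin \o (fun omega => f (Num.min (Y omega) y))).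
Proof. by apply: (bounded_integrable (K' := K)). Qed.

Let clipped_expectationB y z :
  clipped_expectation Y z - clipped_expectation Y y =
  \int[P]_omega (f (Num.min (Y omega) z) - f (Num.min (Y omega) y)).
Proof. by rewrite -RintegralB. Qed.

Let Rintegral_le_cst (g : Omega -> R) (c : R) : measurable_fun setT g ->
  (forall omega, `|g omega| <= c) -> `|\int[P]_omega g omega| <= c.
Proof.
move=> mg gc; have ig := bounded_integrable mg gc.
apply: le_trans (le_normr_Rintegral _ ig) _ => //.
apply: (@le_trans _ _ (\int[P]_(_ in setT) c)).
  apply: le_Rintegral => //.
  - apply: (bounded_integrable (K' := c)); first exact: measurableT_comp.
    by move=> omega; rewrite normr_id.
  - by apply: (bounded_integrable (K' := `|c|)); first exact: measurable_cst.
by rewrite Rintegral_cst//= probability_setT mulr1.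
Qed.

Lemma continuous_clipped_expectation : continuous (clipped_expectation Y).
Proof.
move=> y; apply/cvgrPdist_le => e e0.
pose N : R := `|y| + 1.
have [k kP] := uniform_continuity_segment N cf e0.
apply/nbhs_ballP; exists (Num.min 1 k.+1%:R^-1) => /=.
  by rewrite lt_min ltr01 invr_gt0/=.
move=> z; rewrite /ball/= lt_min => /andP[yz1 yzk].
rewrite clipped_expectationB; apply: Rintegral_le_cst => [|omega].
  exact: measurable_funB.
apply/ltW/kP.
  rewrite /N; have [Yy|yY] := leP (Y omega) y; last by rewrite lerDl.
  by rewrite ger0_norm// (le_trans Yy)// (le_trans (ler_norm y))// lerDl.
apply: le_lt_trans yzk.
have [Yy|yY] := leP (Y omega) y; have [Yz|zY] := leP (Y omega) z.
- by rewrite subrr normr0.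
- by rewrite !ger0_norm ?subr_ge0; lra.
- by rewrite !ler0_norm ?subr_le0; lra.
- by [].
Qed.

(** The strip is open at [y], so it shrinks to the empty set even if [Y] has an atom at [y]. *)
Let vanishing_strip (y e : R) : 0 < e -> exists2 delta, 0 < delta &
  fine (P [set omega | y < Y omega < y + delta]) <= e.
Proof.
move=> e0; pose A (n : nat) := [set omega | y < Y omega < y + n.+1%:R^-1].
have mA n : measurable (A n).
  rewrite (_ : A n = Y @^-1` `]y, (y + n.+1%:R^-1)[).
    by rewrite -[X in measurable X]setTI; apply: mY => //; exact: measurable_itv.
  by apply/seteqP; split => omega /=; rewrite in_itv.
have A0 : \bigcap_n A n = set0.
  apply/seteqP; split => // omega Aomega.
  have /= /andP[yY _] := Aomega 0%N I.
  have Yy0 : 0 < Y omega - y by rewrite subr_gt0.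
  have [n _ /(_ n (leqnn _)) /= nY] := near_infty_natSinv_lt (PosNum Yy0).
  by have /= /andP[_] := Aomega n I; move: nY; move: (n.+1%:R^-1) => c *; lra.
have : P \o A @ \oo --> P (\bigcap_n A n).
  apply: nonincreasing_cvg_mu => //.
  - by rewrite -ge0_fin_numE//; exact: fin_num_measure.
  - exact: bigcap_measurableType.
  - move=> m n mn; apply/subsetPset => omega /andP[yY Yn].
    rewrite /A/= yY/= (lt_le_trans Yn)//.
    by rewrite lerD2l lef_pV2 ?posrE// ler_nat.
rewrite A0 measure0 => /fine_cvgP[_] /cvgrPdist_le /(_ _ e0) [n _ /(_ n (leqnn _)) /=].
rewrite sub0r normrN ger0_norm ?fine_ge0// => An.
by exists n.+1%:R^-1 => //; rewrite invr_gt0.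
Qed.

(** The increment is 0 where [Y <= y] and equals that of [f] where [Y >= y + h]. In between it is
    compared with [l * h] up to an error of order [h], on an event of small probability. *)
Lemma clipped_expectation_right_derivative (y l : R) :
  (forall eta, 0 < eta -> exists2 delta, 0 < delta & forall h, 0 < h ->
     h < delta -> `|f (y + h) - f y - l * h| <= eta * h) ->
  forall eta, 0 < eta -> exists2 delta, 0 < delta & forall h, 0 < h ->
     h < delta -> `|clipped_expectation Y (y + h) - clipped_expectation Y y
       - l * fine (P [set omega | y < Y omega]) * h| <= eta * h.
Proof.
move=> fl eta eta0.
have l1 : 0 < `|l| + 1 by rewrite ltr_wpDl.
have [d1 d10 d1P] := fl (eta / 2) ltac:(by rewrite divr_gt0).
(* Chosen so that the strip contributes at most [eta / 2 * h]; adding 1 to the norm of [l] covers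
   [l = 0]. *)
have [d2 d20 d2P] := vanishing_strip y (e := eta / 2 / (`|l| + 1))
  ltac:(by rewrite !divr_gt0).
exists (Num.min d1 d2); first by rewrite lt_min d10.
move=> h h0; rewrite lt_min => /andP[hd1 hd2].
pose A := [set omega | y < Y omega < y + d2].
pose B := [set omega | y < Y omega].
have mA : measurable A.
  rewrite (_ : A = Y @^-1` `]y, (y + d2)[).
    by rewrite -[X in measurable X]setTI; apply: mY => //; exact: measurable_itv.
  by apply/seteqP; split => omega /=; rewrite in_itv.
have mB : measurable B by exact: measurable_gt_preimage.
have m1 C : measurable C -> measurable_fun setT (\1_C : Omega -> R).
  by move=> mC; exact: measurable_indic.
have i1 C (k : R) : measurable C ->
    P.-integrable setT (EFin \o (fun omega => k * \1_C omega)).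
  move=> mC; apply: (bounded_integrable (K' := `|k|)).
    by apply: measurable_funM; [exact: measurable_cst|exact: m1].
  by move=> omega; rewrite normrM indicE; case: (_ \in _);
    rewrite ?normr1 ?mulr1// normr0 mulr0.
have E1 C (k : R) : measurable C ->
    \int[P]_omega (k * \1_C omega) = k * fine (P C).
  move=> mC; rewrite /Rintegral.
  rewrite (_ : (fun omega => _) = fun omega => (k%:E * (\1_C omega)%:E)%E)//.
  rewrite integralZl//; last first.
    have := i1 C 1 mC; congr (P.-integrable setT _); apply/funext => omega /=.
    by rewrite mul1r.
  by rewrite integral_indic// setIT fineM// fin_num_measure.
pose D omega := f (Num.min (Y omega) (y + h)) - f (Num.min (Y omega) y)
  - l * h * \1_B omega.
have mD : measurable_fun setT D.
  apply: measurable_funB; first exact: measurable_funB.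
  by apply: measurable_funM; [exact: measurable_cst|exact: m1].
have -> : clipped_expectation Y (y + h) - clipped_expectation Y y
    - l * fine (P B) * h = \int[P]_omega D omega.
  rewrite RintegralB//; last 2 first.
  - apply: (bounded_integrable (K' := K + K)); first exact: measurable_funB.
    by move=> omega; apply: le_trans (ler_normB _ _) _; rewrite lerD.
  - exact: i1.
  by rewrite -clipped_expectationB E1// mulrAC.
have Dle omega : `|D omega| <= eta / 2 * h + `|l| * h * \1_A omega.
  rewrite /D !indicE; have [yY|Yy] := ltP y (Y omega); last first.
    have Yyh : Y omega <= y + h by lra.
    rewrite (min_l Yyh) ?(min_l Yy).
    rewrite [omega \in B]memNset ?mulr0 ?subrr ?subr0 ?normr0; last first.
      by rewrite /B/=; apply/negP; rewrite -leNgt.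
    by rewrite addr_ge0// !mulr_ge0// ltW.
  rewrite ?(min_r (ltW yY)) [omega \in B]mem_set// mulr1.
  have [Yh|hY] := ltP (Y omega) (y + h); last first.
    rewrite ?(min_r hY); apply: le_trans (d1P h h0 hd1) _.
    by rewrite lerDl !mulr_ge0// ltW.
  rewrite ?(min_l (ltW Yh)) mem_set; last first.
    by rewrite /A/= yY/=; apply: (lt_trans Yh); rewrite ltrD2l.
  pose h' := Y omega - y.
  have h'0 : 0 < h' by rewrite subr_gt0.
  have h'h : h' < h by rewrite /h'; lra.
  have := d1P h' h'0 (lt_trans h'h hd1).
  rewrite {1}/h' (addrC y) subrK => fY.
  rewrite mulr1 (_ : _ - _ - _ =
    (f (Y omega) - f y - l * h') - l * (h - h')); last by ring.
  apply: le_trans (ler_normB _ _) _; apply: lerD.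
    by apply: (le_trans fY); rewrite ler_pM2l ?divr_gt0// ltW.
  rewrite normrM ler_wpM2l// ger0_norm; lra.
have iD : P.-integrable setT (EFin \o D).
  apply: (bounded_integrable (K' := eta / 2 * h + `|l| * h)) => // omega.
  apply: (le_trans (Dle omega)); rewrite lerD2l indicE.
  by case: (_ \in _); rewrite ?mulr1// mulr0 mulr_ge0// ltW.
apply: le_trans (le_normr_Rintegral _ iD) _ => //.
apply: (@le_trans _ _ (\int[P]_omega (eta / 2 * h + `|l| * h * \1_A omega))).
  apply: le_Rintegral => //.
  - by have := integrable_abse iD.
  - have := integrableD measurableT (i1 setT (eta / 2 * h) measurableT)
      (i1 A (`|l| * h) mA).
    congr (P.-integrable setT _); apply/funext => omega /=.
    by rewrite indicE mem_set// mulr1.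
have ic : P.-integrable setT (EFin \o cst (eta / 2 * h)).
  by apply: (bounded_integrable (K' := `|eta / 2 * h|)); first exact: measurable_cst.
rewrite RintegralD//; last exact: i1.
rewrite Rintegral_cst//= probability_setT mulr1 E1//.
apply: (@le_trans _ _ (eta / 2 * h + eta / 2 * h)); last by lra.
rewrite lerD2l mulrAC ler_pM2r//.
apply: (@le_trans _ _ (`|l| * (eta / 2 / (`|l| + 1)))).
  by rewrite ler_wpM2l.
rewrite mulrCA; apply: ler_piMr; first by rewrite divr_ge0// ltW.
by rewrite ler_pdivrMr// mul1r lerDl.
Qed.

Lemma clipped_expectation_ge (b : R) : (forall y, b <= y -> f y = 0) ->
  (clipped_expectation Y b)%:E = 'E_P[f \o Y]%E.
Proof.
move=> fb; rewrite /clipped_expectation /Rintegral fineK; last first.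
  by apply: integrable_fin_num => //; exact: integrable_clip.
rewrite unlock; apply: eq_integral => omega _; rewrite /=; congr (_%:E).
by have [//|bY] := leP (Y omega) b; rewrite !fb// ltW.
Qed.

End clipped_expectation.

(** * The right-continuous inverse as a random variable *)

Section clipped_inverse.
Context {R : realType}.
Implicit Types (x b y : R) (g : R -> R).

(* The infimum is taken over positive rationals and clipped at [b], which avoids the
   junk value [inf set0 = 0]; a function vanishing at 0 and beyond [b] does not see
   the difference. *)
Definition inverse_term x b g (n : nat) : R :=
  if unpickle n is Some q then
    if (0 < (q : rat)) && (x < g (ratr q)) then Num.min (ratr q) b else b
  else b.

Definition clipped_inverse x b g : R := infs (inverse_term x b g) 0.

Lemma inverse_term_lbound x b g : 0 < b -> lbound (range (inverse_term x b g)) 0.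
Proof.
move=> b0 _ [n _ <-]; rewrite /inverse_term; case: unpickle => [q|]; last exact: ltW.
case: ifPn => [/andP[q0 _]|_]; last exact: ltW.
by rewrite le_min ler0q !ltW.
Qed.

Lemma clipped_inverseE x b g : clipped_inverse x b g = inf (range (inverse_term x b g)).
Proof.
rewrite /clipped_inverse /infs /sdrop; congr inf.
by apply/seteqP; split => _ [n _ <-]; exists n.
Qed.

Lemma clipped_inverse_le_term x b g n : 0 < b ->
  clipped_inverse x b g <= inverse_term x b g n.
Proof.
move=> b0; rewrite clipped_inverseE; apply: ge_inf; last by exists n.
by exists 0; exact: inverse_term_lbound.
Qed.

Lemma le_clipped_inverse x b g c :
  (forall n, c <= inverse_term x b g n) -> c <= clipped_inverse x b g.
Proof.
move=> cle; rewrite clipped_inverseE; apply: lb_le_inf.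
  by exists (inverse_term x b g 0); exists 0%N.
by move=> _ [n _ <-].
Qed.

Lemma clipped_inverse_ge0 x b g : 0 < b -> 0 <= clipped_inverse x b g.
Proof.
move=> b0; apply: le_clipped_inverse => n.
by apply: (@inverse_term_lbound x b g b0 (inverse_term x b g n)); exists n.
Qed.

Lemma clipped_inverse_le x b g y : 0 < b ->
  (forall u v, 0 <= u -> u <= v -> g u <= g v) ->
  0 <= y -> x < g y -> clipped_inverse x b g <= y.
Proof.
move=> b0 mono y0 xgy; apply/ler_addgt0Pr => e e0.
have ye : y < y + e by rewrite ltrDl.
have [q] := rat_in_itvoo ye; rewrite in_itv/= => /andP[yq qye].
have q0 : 0 < ratr q :> R by exact: le_lt_trans yq.
apply: (le_trans (clipped_inverse_le_term x g (pickle q) b0)).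
rewrite /inverse_term pickleK ifT; first by rewrite ge_min ltW.
rewrite -(ltr0q R) q0/= (lt_le_trans xgy)//.
by apply: mono => //; exact: ltW.
Qed.

Lemma clipped_inverse_lt x b g y :
  (forall u v, 0 <= u -> u <= v -> g u <= g v) -> y <= b ->
  clipped_inverse x b g < y -> x < g y.
Proof.
move=> mono yb; rewrite clipped_inverseE => /inf_lt -[].
  by exists (inverse_term x b g 0); exists 0%N.
move=> _ [n _ <-]; rewrite /inverse_term.
case: unpickle => [q|]; last by move=> /lt_geF; rewrite yb.
case: ifPn => [/andP[q0 xgq]|_]; last by move=> /lt_geF; rewrite yb.
rewrite gt_min => /orP[qy|by_]; last by move: by_; rewrite ltNge yb.
have q0' : 0 <= ratr q :> R by rewrite ler0q ltW.
by apply: (lt_le_trans xgq); apply: mono => //; exact: ltW.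
Qed.

(** If no value of [g] exceeds [x], the inverse takes the value 0 and the clipped one is at least
    [b], and [f] vanishes at both. Otherwise the two coincide or both are at least [b]. *)
Lemma rc_inverse_clipped (f : R -> R) x b g : 0 < b ->
  (forall u v, 0 <= u -> u <= v -> g u <= g v) ->
  f 0 = 0 -> (forall y, b <= y -> f y = 0) ->
  f (rc_inverse g x) = f (clipped_inverse x b g).
Proof.
move=> b0 mono f0 fb; rewrite /rc_inverse; set A := [set y | 0 <= y /\ x < g y].
have [A0|/set0P A0] := eqVneq A set0.
  rewrite A0 inf0 f0 fb//; apply: le_clipped_inverse => n; rewrite /inverse_term.
  case: unpickle => [q|//]; case: ifPn => // /andP[q0 xgq].
  suff : A (ratr q) by rewrite A0.
  by split; rewrite ?ler0q ?ltW.
have lbA : has_lbound A by exists 0 => y [].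
have infA0 : 0 <= inf A by apply: lb_le_inf => // y [].
have cA : clipped_inverse x b g <= inf A.
  apply: lb_le_inf => // y [y0 xgy]; exact: clipped_inverse_le.
have Ac : Num.min (inf A) b <= clipped_inverse x b g.
  apply: le_clipped_inverse => n; rewrite /inverse_term.
  case: unpickle => [q|]; last by rewrite ge_min lexx orbT.
  case: ifPn => [/andP[q0 xgq]|_]; last by rewrite ge_min lexx orbT.
  rewrite le_min !ge_min lexx orbT andbT; apply/orP; left.
  by apply: ge_inf => //; split => //; rewrite ler0q ltW.
have [Ab|bA] := leP (inf A) b.
  congr f; apply/eqP; rewrite eq_le cA andbT; apply: le_trans Ac.
  by rewrite ?min_l.
rewrite !fb//; last exact: ltW.
by apply: le_trans Ac; rewrite ?min_r// ltW.
Qed.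

End clipped_inverse.

Section dual.
Context {d : measure_display} {Omega : measurableType d} {R : realType}.
Variable P : probability Omega R.

Lemma measurable_clipped_inverse (Z : R -> Omega -> R) (x b : R) : 0 < b ->
  (forall y, 0 < y -> measurable_fun setT (Z y)) ->
  measurable_fun setT (fun omega => clipped_inverse x b (Z ^~ omega)).
Proof.
move=> b0 mZ; apply: (@measurable_fun_infs _ _ _ setT
    (fun n omega => inverse_term x b (Z ^~ omega) n)).
  by move=> omega _; exists 0; exact: inverse_term_lbound.
move=> n; rewrite /inverse_term; case: unpickle => [q|]; last exact: measurable_cst.
have [q0|q0] := boolP (0 < q); last exact: measurable_cst.
apply: measurable_fun_ifT; [|exact: measurable_cst|exact: measurable_cst].
apply: measurable_fun_ltr; first exact: measurable_cst.
by apply: mZ; rewrite ltr0q.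
Qed.

(** Tonelli on the graph of [Y]: its section at each [omega] is a single point, hence
    Lebesgue-null. *)
Lemma ae_no_atom (Y : Omega -> R) : measurable_fun setT Y ->
  {ae (lebesgue_measure : {measure set (measurableTypeR R) -> \bar R}),
    forall y, P [set omega | Y omega = y] = 0%E}.
Proof.
move=> mY; pose mu := @lebesgue_measure R.
pose F (z : Omega * R) : \bar R := (\1_[set z : Omega * R | Y z.1 - z.2 = 0] z)%:E.
have mD : measurable [set z : Omega * R | Y z.1 - z.2 = 0].
  have mYz : measurable_fun setT (fun z : Omega * R => Y z.1 - z.2).
    by apply: measurable_funB => //; exact: (measurableT_comp mY measurable_fst).
  by rewrite -[X in measurable X]setTI; exact: (mYz measurableT [set 0]).
have mF : measurable_fun setT F by apply/measurable_EFinP; exact: measurable_indic.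
have F0 z : (0 <= F z)%E by rewrite lee_fin.
have FP y : P [set omega | Y omega = y] = (\int[P]_omega F (omega, y))%E.
  rewrite (_ : (fun omega => _) =
      fun omega => (\1_[set omega | Y omega = y] omega : R)%:E).
    rewrite integral_indic ?setIT//.
    by rewrite -[X in measurable X]setTI; exact: (mY measurableT [set y]).
  apply/funext => omega; rewrite /F !indicE; congr (nat_of_bool _)%:R%:E.
  by apply/idP/idP; rewrite !inE/= => /eqP; rewrite ?subr_eq0 => /eqP E;
    apply/eqP; rewrite ?subr_eq0 ?E.
have mG : measurable_fun setT (fun y => \int[P]_omega F (omega, y))%E.
  exact: (measurable_fun_fubini_tonelli_G F).
have G0 : (\int[mu]_y \int[P]_omega F (omega, y) = 0)%E.
  have <- := @fubini_tonelli _ _ Omega (measurableTypeR R) R P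
    (@lebesgue_measure R) F mF F0.
  apply: integral0_eq => omega _.
  rewrite (_ : (fun y => _) = fun y => (\1_[set Y omega] y : R)%:E).
    rewrite integral_indic//= setIT; exact: lebesgue_measure_set1.
  apply/funext => y; rewrite /F !indicE; congr (nat_of_bool _)%:R%:E.
  by apply/idP/idP; rewrite !inE/= => /eqP; rewrite ?subr_eq0 => /eqP E;
    apply/eqP; rewrite ?subr_eq0 ?E.
have : (\int[mu]_y `|\int[P]_omega F (omega, y)| = 0)%E.
  rewrite -[RHS]G0; apply: eq_integral => y _; rewrite gee0_abs//.
  exact: integral_ge0.
move/(ae_eq_integral_abs mu measurableT mG).
by apply: filterS => y /(_ I) /= <-.
Qed.

(** Flow and scheme enter the sequel only as measurable families that are almost surely monotone, so
    one statement serves both. [Num.max 0] extends the test function continuously to the line, its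
    values at negative reals being arbitrary. *)
Lemma dual_clipped (Z : R -> Omega -> R) (f : R -> R) (x b : R) :
  0 < b -> continuous (fun y : R => f (Num.max 0 y) : R) ->
  (forall y, 0 < y -> measurable_fun setT (Z y)) ->
  {ae P, forall omega, forall u v, 0 <= u -> u <= v -> Z u omega <= Z v omega} ->
  f 0 = 0 -> (forall y, b <= y -> f y = 0) ->
  exists Y : Omega -> R, [/\ measurable_fun setT Y, forall omega, 0 <= Y omega,
    ('E_P[fun omega => f (rc_inverse (Z ^~ omega) x)] =
      'E_P[((fun y : R => f (Num.max 0 y)) \o Y)%R])%E
    & {ae (lebesgue_measure : {measure set (measurableTypeR R) -> \bar R}),
       forall y, 0 < y -> y < b ->
       fine (P [set omega | x < Z y omega]) =
       1 - fine (P [set omega | y < Y omega])}].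
Proof.
move=> b0 cf mZ monoZ f0 fb.
pose Y omega := clipped_inverse x b (Z ^~ omega).
have mY : measurable_fun setT Y by exact: measurable_clipped_inverse.
have Y0 omega : 0 <= Y omega by exact: clipped_inverse_ge0.
exists Y; split => //.
  rewrite unlock; apply: integral_ae_nonmeasurable.
    apply/measurable_EFinP.
    exact: (measurableT_comp (continuous_measurable_fun cf) mY).
  apply: filterS monoZ => omega mono; rewrite /= (rc_inverse_clipped _ b0)//.
  by rewrite max_r.
have := ae_no_atom mY; apply: (@filterS _ _ (ae_filter_ringOfSetsType _)) => y PY y0 yb.
have mYy : measurable [set omega | y < Y omega] by exact: measurable_gt_preimage.
have -> : P [set omega | x < Z y omega] = P (~` [set omega | y < Y omega]).
  apply: eq_measure_ae.
  - by apply: measurable_gt_preimage; exact: mZ.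
  - exact: measurableC.
  have aeY : {ae P, forall omega, Y omega != y}.
    exists [set omega | Y omega = y]; split => //.
      by rewrite -[X in measurable X]setTI; exact: (mY measurableT [set y]).
    by move=> omega /= /negP; rewrite negbK => /eqP.
  apply: filterS2 monoZ aeY => omega mono Yy /=; split => [xZ|].
    by apply/negP; rewrite -leNgt; apply: clipped_inverse_le => //; exact: ltW.
  move=> /negP; rewrite -leNgt => Yley.
  apply: (@clipped_inverse_lt R x b (Z ^~ omega) y mono (ltW yb)).
  by rewrite lt_neqAle Yy.
by rewrite probability_setC// fineB// fin_num_measure.
Qed.

End dual.

Section test_function.
Context {R : realType}.
Variable f : R -> R.
Hypothesis f_diff : differentiable_from0 f.
Hypothesis f_supp : compact_support_from0 f.
Let ft (y : R) : R := f (Num.max 0 y).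

Lemma support_bounded : exists2 M : R, 0 < M & forall y, M <= y -> f y = 0.
Proof.
have [M [Mreal MP]] := compact_bounded f_supp.
have M1 : M < Num.max M 0 + 1.
  by apply: le_lt_trans (_ : M <= Num.max M 0) _; rewrite ?le_max ?lexx// ltrDl.
have := MP _ M1; rewrite /= => MS.
have M0 : 0 <= Num.max M 0 by rewrite le_max lexx orbT.
exists (Num.max M 0 + 2) => [|y My]; first by lra.
apply/eqP; apply: contraT => fy; suff : `|y| <= Num.max M 0 + 1.
  by rewrite ger0_norm; lra.
by apply: MS; apply: subset_closure; split => //; lra.
Qed.

(** At 0 the derivative [derive1] would look at negative arguments, where [f] is arbitrary; the
    one-sided limit is put there instead. *)
Definition right_derivative_from0 (l y : R) : R := if y == 0 then l else f^`() y.

Lemma right_derivative_from0P : exists l : R, forall y, 0 <= y -> forall eta, 0 < eta ->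
  exists2 delta, 0 < delta & forall h, 0 < h -> h < delta ->
    `|f (y + h) - f y - right_derivative_from0 l y * h| <= eta * h.
Proof.
have [[l fl] df] := f_diff; exists l => y y0 eta eta0.
have key (l' c h : R) : 0 < h -> `|l' - c / h| <= eta -> `|c - l' * h| <= eta * h.
  move=> h0; rewrite -(ler_pM2r h0) -{2}(gtr0_norm h0) -normrM mulrBl.
  by rewrite mulfVK ?gt_eqF// distrC.
rewrite /right_derivative_from0; case: eqP => [->|/eqP yn0].
  have /cvgrPdist_le /(_ _ eta0) := fl.
  rewrite near_withinE => /nbhs_ballP[delta /= delta0 deltaP].
  exists delta => // h h0 hd; rewrite add0r; apply: key => //.
  by apply: deltaP => //; rewrite /ball/= sub0r normrN gtr0_norm.
have yp : 0 < y by rewrite lt_neqAle eq_sym yn0.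
have := df y yp; rewrite /derivable => /cvgrPdist_le /(_ _ eta0).
rewrite near_withinE => /nbhs_ballP[delta /= delta0 deltaP].
exists delta => // h h0 hd; apply: key => //.
have := deltaP h; rewrite /ball/= sub0r normrN gtr0_norm// gt_eqF// => /(_ hd isT).
rewrite -/(derive f y 1) derive1E.
by rewrite /= scaler1 [h + y]addrC mulrC.
Qed.

Lemma continuous_test_function : continuous ft.
Proof.
have [l fl] := right_derivative_from0P.
have [_ df] := f_diff.
have max0 (y : R) : 0 <= Num.max 0 y by rewrite le_max lexx.
suff cont a e : 0 <= a -> 0 < e -> exists2 delta, 0 < delta &
    forall a', 0 <= a' -> `|a - a'| < delta -> `|f a - f a'| <= e.
  move=> y; apply/cvgrPdist_le => e e0.
  have [delta delta0 deltaP] := cont _ _ (max0 y) e0.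
  apply/nbhs_ballP; exists delta => // z; rewrite /ball/= => yz.
  by apply: deltaP => //; exact: le_lt_trans (dist_max0 _ _) yz.
move=> a0 e0; have [a0'|] := ltP 0 a.
  have /derivable1_diffP/differentiable_continuous/cvgrPdist_le := df a a0'.
  move=> /(_ _ e0) /nbhs_ballP[delta /= delta0 deltaP].
  by exists delta => // a' _ aa'; exact: deltaP.
move=> a0'; have {a0'}-> : a = 0 by apply/eqP; rewrite eq_le a0' a0.
have [delta delta0 deltaP] := fl 0 (lexx _) 1 ltr01.
set c := right_derivative_from0 l 0 in deltaP.
have c1 : 0 < 1 + `|c| by rewrite ltr_pwDl.
exists (Num.min delta (e / (1 + `|c|))); first by rewrite lt_min delta0 divr_gt0.
move=> a' a'0; rewrite sub0r normrN ger0_norm// lt_min ltr_pdivlMr// => /andP[ad ae].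
have [->|a'n0] := eqVneq a' 0; first by rewrite subrr normr0 ltW.
have a'p : 0 < a' by rewrite lt_neqAle eq_sym a'n0.
have := deltaP a' a'p ad; rewrite add0r mul1r => fa'.
apply: le_trans (ltW ae); rewrite distrC mulrDr mulr1.
rewrite (_ : f a' - f 0 = (f a' - f 0 - c * a') + c * a'); last by ring.
apply: le_trans (ler_normD _ _) _; rewrite lerD//.
by rewrite normrM [leRHS]mulrC (ger0_norm a'0).
Qed.

Lemma bounded_test_function : exists K, forall y, `|ft y| <= K.
Proof.
have [M M0 fM] := support_bounded.
have cn : {within `[0, M], continuous (fun y => `|ft y|)}.
  apply: continuous_subspaceT => y.
  by apply: (continuous_comp (@continuous_test_function y)); exact: norm_continuous.
have [c _ cmax] := EVT_max (ltW M0) cn.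
exists `|ft c| => y; have [yM|My] := leP y M.
  have [y0|y0] := leP 0 y; first by apply: cmax; rewrite in_itv/= y0.
  rewrite (_ : ft y = ft 0); last by rewrite /ft max_l ?ltW// max_l.
  by apply: cmax; rewrite in_itv/= lexx ltW.
rewrite /ft max_r; last by rewrite (le_trans (ltW M0))// ltW.
by rewrite fM ?normr0// ltW.
Qed.

Lemma measurable_right_derivative l : (forall y, 0 <= y -> forall eta, 0 < eta ->
  exists2 delta, 0 < delta & forall h, 0 < h -> h < delta ->
    `|f (y + h) - f y - right_derivative_from0 l y * h| <= eta * h) ->
  measurable_fun (`[0, +oo[ : set R) (right_derivative_from0 l).
Proof.
move=> fl; apply: (@measurable_fun_cvg _ _ _ _
  (fun (n : nat) (y : R) => (ft (y + n.+1%:R^-1) - ft y) * n.+1%:R)).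
  move=> n; apply: measurable_funTS; apply: measurable_funM; last exact: measurable_cst.
  have mft := continuous_measurable_fun continuous_test_function.
  apply: measurable_funB => //; apply: (measurableT_comp mft).
  by apply: measurable_funD => //; exact: measurable_cst.
move=> y /=; rewrite in_itv/= andbT => y0; apply/cvgrPdist_le => eta eta0.
have [delta delta0 deltaP] := fl y y0 eta eta0.
near=> n.
have n0 : 0 < n.+1%:R^-1 :> R by rewrite invr_gt0.
have : n.+1%:R^-1 < delta by near: n; exact: (near_infty_natSinv_lt (PosNum delta0)).
move=> /(deltaP _ n0).
rewrite /ft (max_r y0) max_r ?addr_ge0 ?(ltW n0)//.
set c := f _ - f y; set p := right_derivative_from0 l y.
have nh : n.+1%:R^-1 * n.+1%:R = 1 :> R by rewrite mulVf.
have np : 0 < n.+1%:R :> R by rewrite ltr0n.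
rewrite -(ler_pM2r np) -mulrA nh mulr1 -[X in _ * X <= _](gtr0_norm np) -normrM.
by rewrite mulrBl -mulrA nh mulr1 distrC.
Unshelve. all: by end_near. Qed.

End test_function.

Section expectation_difference.
Context {d : measure_display} {Omega : measurableType d} {R : realType}.
Variable P : probability Omega R.
Local Notation mu := (@lebesgue_measure R).

Lemma tail_nonincreasing (Y : Omega -> R) : measurable_fun setT Y ->
  nonincreasing_fun (fun y => fine (P [set omega | y < Y omega])).
Proof.
move=> mY y z yz; apply: fine_le; rewrite ?fin_num_measure//.
- exact: measurable_gt_preimage.
- exact: measurable_gt_preimage.
- apply: le_measure; [exact/mem_set/measurable_gt_preimage|
    exact/mem_set/measurable_gt_preimage|].
  by move=> omega /=; exact: le_lt_trans.
Qed.

(** [G] agrees with the difference [H] of the tails only almost everywhere, while the slope is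
    needed at every point. The fundamental theorem is therefore applied with [H], and [G] returns by
    a change on a null set. *)
Lemma expectation_difference (f G : R -> R) (M b : R) (Y Y' : Omega -> R) :
  differentiable_from0 f -> compact_support_from0 f -> f 0 = 0 ->
  0 < M -> M < b -> (forall y, M <= y -> f y = 0) ->
  measurable_fun setT Y -> (forall omega, 0 <= Y omega) ->
  measurable_fun setT Y' -> (forall omega, 0 <= Y' omega) ->
  mu.-integrable (`]0, +oo[ : set R) (fun y => (derive1 f y * G y)%:E) ->
  {ae (lebesgue_measure : {measure set (measurableTypeR R) -> \bar R}),
    forall y, 0 < y -> y < b -> G y = fine (P [set omega | y < Y omega]) -
      fine (P [set omega | y < Y' omega])} ->
  ('E_P[((fun y : R => f (Num.max 0 y)) \o Y)%R]
     - 'E_P[((fun y : R => f (Num.max 0 y)) \o Y')%R]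
   = \int[mu]_(y in `]0%R, +oo[) (derive1 f y * G y)%R%:E)%E.
Proof.
move=> f_diff f_supp f0 M0 Mb fM mY Y0 mY' Y'0 iG aeG.
have b0 : 0 < b by exact: lt_trans Mb.
have [l fl] := right_derivative_from0P f_diff.
have cft := continuous_test_function f_diff.
have [K ftK] := bounded_test_function f_diff f_supp.
set ft := fun y : R => f (Num.max 0 y) in cft ftK *.
have ft0 (y : R) : 0 <= y -> ft y = f y by move=> y0; rewrite /ft max_r.
have ftb y : b <= y -> ft y = 0.
  move=> yb; rewrite ft0; last by rewrite (le_trans _ yb)// ltW.
  by apply: fM; rewrite (le_trans _ yb)// ltW.
pose fp := right_derivative_from0 f l.
have fpE y : 0 < y -> fp y = derive1 f y.
  by move=> y0; rewrite /fp /right_derivative_from0 gt_eqF.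
pose H y := fine (P [set omega | y < Y omega]) - fine (P [set omega | y < Y' omega]).
pose phi y := fp y * H y.
pose F y := clipped_expectation P ft Y y - clipped_expectation P ft Y' y.
(* [f] is 0 at [y] and to its right, so its right slope vanishes; this lets the integral over the
   half-line stop at [b]. *)
have fpM y : M < y -> fp y = 0.
  move=> My; have y0 : 0 <= y by rewrite ltW// (lt_trans M0).
  apply/eqP; rewrite -normr_le0; apply/ler_addgt0Pr => eta eta0; rewrite add0r.
  have [delta delta0 deltaP] := fl y y0 eta eta0.
  have h0 : 0 < delta / 2 by rewrite divr_gt0.
  have hd : delta / 2 < delta by lra.
  have := deltaP _ h0 hd; rewrite !fM ?subrr ?sub0r; last 2 first.
  - exact: ltW.
  - by lra.
  by rewrite normrN normrM (gtr0_norm h0) ler_pM2r.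
have mphi : measurable_fun (`[0, +oo[ : set R) phi.
  apply: measurable_funM; first exact: measurable_right_derivative.
  apply: measurable_funTS; apply: measurable_funB;
    by apply: nonincreasing_measurable => //; exact: tail_nonincreasing.
have mphib : measurable_fun (`]0, b[ : set R) phi.
  apply: measurable_funS mphi => // y /=; rewrite !in_itv/= andbT => /andP[y0 _].
  exact: ltW.
have mG : measurable_fun (`]0, b[ : set R) (fun y => (derive1 f y * G y)%:E).
  case/integrableP : iG => mG _; apply: measurable_funS mG => // y /=.
  by rewrite !in_itv/= andbT => /andP[].
have aeE : ae_eq mu (`]0, b[ : set R) (fun y => (derive1 f y * G y)%:E) (EFin \o phi).
  move: aeG; apply: (@filterS _ _ (ae_filter_ringOfSetsType _)) => y Gy.
  rewrite /= in_itv/= => /andP[y0 yb].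
  by rewrite /phi /H fpE// Gy.
have iphi : mu.-integrable (`[0, b] : set R) (EFin \o phi).
  have mphi0b : measurable_fun (`[0, b] : set R) phi.
    apply: measurable_funS mphi => // y /=; rewrite !in_itv/= andbT.
    by case/andP.
  apply/integrableP; split; first exact/measurable_EFinP.
  rewrite integral_itv_bndoo; last first.
    by apply/measurable_EFinP; apply: measurableT_comp.
  have -> : (\int[mu]_(y in `]0%R, b[) `|(EFin \o phi) y| =
      \int[mu]_(y in `]0%R, b[) `|(derive1 f y * G y)%:E|)%E.
    apply: ae_eq_integral => //.
    - by apply: measurableT_comp => //; exact/measurable_EFinP.
    - exact: measurableT_comp.
    - exact/ae_eq_abse/ae_eq_sym.
  case/integrableP : iG => mG0; apply: le_lt_trans.
  apply: ge0_subset_integral => //; first exact: measurableT_comp.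
  by move=> y /=; rewrite !in_itv/= andbT => /andP[].
have := @integral_right_derivative R F phi 0 b (ltW b0).
have -> : F 0 = 0.
  rewrite /F /clipped_expectation -[RHS](subrr (\int[P]_omega ft 0)).
  congr (_ - _); rewrite /Rintegral; congr fine; apply: eq_integral => omega _;
    by rewrite min_r.
rewrite subr0 /F EFinB !(clipped_expectation_ge P cft ftK)//.
move=> <-//; first last.
- move=> y y0 yb eta eta0.
  have eta2 : 0 < eta / 2 by rewrite divr_gt0.
  have ftl eta' : 0 < eta' -> exists2 delta, 0 < delta & forall h, 0 < h ->
      h < delta -> `|ft (y + h) - ft y - fp y * h| <= eta' * h.
    move=> eta'0; have [delta delta0 deltaP] := fl y y0 eta' eta'0.
    exists delta => // h h0 hd; rewrite !ft0//; first exact: deltaP.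
    by rewrite addr_ge0// ltW.
  have [d1 d10 d1P] := clipped_expectation_right_derivative P cft ftK mY ftl eta2.
  have [d2 d20 d2P] := clipped_expectation_right_derivative P cft ftK mY' ftl eta2.
  exists (Num.min d1 d2); first by rewrite lt_min d10.
  move=> h h0; rewrite lt_min => /andP[hd1 hd2].
  have := d1P h h0 hd1; have := d2P h h0 hd2.
  rewrite /F /phi /H.
  set u := clipped_expectation _ _ Y (y + h) - clipped_expectation _ _ Y y - _.
  set v := clipped_expectation _ _ Y' (y + h) - clipped_expectation _ _ Y' y - _.
  move=> vh uh; rewrite [leLHS](_ : _ = `|u - v|); last first.
    by rewrite /u /v; congr `|_|; ring.
  by apply: le_trans (ler_normB _ _) _; lra.
- move=> c c0 cb; apply: cvg_at_left_filter.
  apply: cvgB; first exact: (continuous_clipped_expectation cft ftK mY Y0).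
  exact: (continuous_clipped_expectation cft ftK mY' Y'0).
rewrite integral_itv_bndoo; last exact/measurable_EFinP.
have -> : (\int[mu]_(y in `]0%R, b[) (phi y)%:E =
    \int[mu]_(y in `]0%R, b[) (derive1 f y * G y)%:E)%E.
  apply: ae_eq_integral => //; first exact/measurable_EFinP.
  exact: ae_eq_sym.
rewrite [LHS]integral_mkcond [RHS]integral_mkcond; apply: eq_integral => y _.
rewrite !patchE; have [yb|by_] := ltP y b.
  congr (if _ then _ else _); apply/idP/idP; rewrite !inE/= !in_itv/= andbT.
    by case/andP.
  by move=> ->.
have ynb : (y \in (`]0, b[ : set R)) = false.
  by rewrite memNset//= in_itv/= (ltNge y b) by_ andbF.
rewrite ynb.
case: ifPn => // _; rewrite -fpE ?fpM ?mul0r//.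
  exact: lt_le_trans by_.
exact: lt_le_trans by_.
Qed.

End expectation_difference.

Unset Implicit Arguments.

Theorem theorem1p0p1 (d : measure_display) (Omega : measurableType d)
    (R : realType) (P : probability Omega R) (w : R -> Omega -> R)
    (sigma b : R -> R) (X : R -> R -> R -> Omega -> R)
    (T : R) (n : nat) (Xn : int -> int -> R -> Omega -> R)
    (f : R -> R) (x : R)
    (w_wiener : is_wiener P w)
    (sigma_borel : measurable_fun (`[0, +oo[ : set R) sigma)
    (b_borel : measurable_fun (`[0, +oo[ : set R) b)
    (sigma_b_cond : standing_conditions sigma b)
    (X_flow : is_absorbing_flow P sigma b w X)
    (T_gt0 : 0 < T) (n_gt0 : (0 < n)%N)
    (Xn_EM : is_euler_maruyama P sigma b w (T / n%:R) Xn)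
    (f_diff : differentiable_from0 f) (f0 : f 0 = 0)
    (f_supp : compact_support_from0 f)
    (x_gt0 : 0 < x)
    (* a differentiable f may have a non-integrable derivative, and then the
       Lebesgue integral in the conclusion is undefined *)
    (rhs_integrable : (@lebesgue_measure R).-integrable (`]0, +oo[ : set R)
       (fun y : R => (derive1 f y * (fine (P [set omega | x < Xn 0 n%:Z y omega])
                    - fine (P [set omega | x < X 0 T y omega])))%:E)) :
  ('E_P[fun omega => f (dual_flow X 0%R T x omega)]
     - 'E_P[fun omega => f (dual_euler_maruyama Xn 0%R n%:Z x omega)]
   = \int[@lebesgue_measure R]_(y in `]0%R, +oo[)
       (derive1 f y * (fine (P [set omega | x < Xn 0%R n%:Z y omega])
          - fine (P [set omega | x < X 0%R T y omega])))%R%:E)%E.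
Proof.
have [M M0 fM] := support_bounded f_supp.
have b0 : 0 < M + 1 by rewrite addr_gt0.
have fb y : M + 1 <= y -> f y = 0 by move=> yb; apply: fM; lra.
have cft := continuous_test_function f_diff.
have mX y : 0 < y -> measurable_fun setT (X (- T) (- 0) y).
  by case: X_flow => mX _ _ y0; apply: mX; rewrite ?oppr0 ?oppr_le0 ltW.
have monoX : {ae P, forall omega, forall u v, 0 <= u -> u <= v ->
    X (- T) (- 0) u omega <= X (- T) (- 0) v omega}.
  case: X_flow => _ regX _; have := regX (- T) (- 0).
  rewrite oppr0 oppr_le0 => /(_ (ltW T_gt0)).
  by apply: filterS => omega [].
have h0 : 0 <= T / n%:R by rewrite divr_ge0// ltW.
have mXn y : 0 < y -> measurable_fun setT (Xn (- n%:Z) (- 0) y).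
  move=> y0; have := measurable_euler_maruyama w_wiener sigma_borel b_borel h0
    (- n%:Z) n Xn_EM y0.
  by rewrite addNr oppr0.
have monoXn : {ae P, forall omega, forall u v, 0 <= u -> u <= v ->
    Xn (- n%:Z) (- 0) u omega <= Xn (- n%:Z) (- 0) v omega}.
  by case: Xn_EM => _ _ _ /(_ (- n%:Z) (- 0)); apply; rewrite oppr0 oppr_le0.
have [Y [mY Y0 EY aeY]] := dual_clipped (P := P) x b0 cft mX monoX f0 fb.
have [Y' [mY' Y'0 EY' aeY']] := dual_clipped (P := P) x b0 cft mXn monoXn f0 fb.
rewrite EY EY'.
apply: (@expectation_difference _ _ _ P f _ M (M + 1)) => //.
  by rewrite ltrDl.
have ae2 := (@filterI _ _ (ae_filter_ringOfSetsType lebesgue_measure) _ _ aeY aeY').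
move: ae2; apply: (@filterS _ _ (ae_filter_ringOfSetsType _)) => y [Yy Y'y] y0 yb.
have XE : P [set omega | x < X 0 T y omega] = P [set omega | x < X (- T) (- 0) y omega].
  have := absorbing_flow_stationary w_wiener sigma_borel b_borel 0 (- T)
    X_flow (ltW T_gt0) (ltW x_gt0) y0.
  by rewrite add0r addNr oppr0.
have XnE : P [set omega | x < Xn 0 n%:Z y omega] =
    P [set omega | x < Xn (- n%:Z) (- 0) y omega].
  have := euler_maruyama_stationary w_wiener sigma_borel b_borel h0 0 (- n%:Z) n x
    Xn_EM y0.
  by rewrite add0r addNr oppr0.
(* Each tail of the dual is the complement of an event of the flow or of the scheme; the constants 1
   cancel and the order of the difference is reversed. *)
by rewrite XE XnE Yy// Y'y//; ring.
Qed.
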